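(* Let $\Delta$ be a $d$-dimensional flag complex. Then the minimal (with respect to inclusion) revlex $(d+1)$-colorable complex $\Gamma$ (with respect to $\Pi_{d+1}$) satisfying $f_d(\Gamma) = f_d(\Delta)$, i.e. the complex generated by the $f_d(\Delta)$ smallest elements of $\binom{\Pi_{d+1}}{d+1}$ in the revlex order, satisfies $\beta_d(\Gamma) \geq \beta_d(\Delta)$.
   Context: A flag complex is a (finite, non-empty) simplicial complex in which every set of pairwise adjacent vertices is a face. $f_i$ counts $i$-dimensional faces. Fix a field $\Bbbk$; $\beta_k=\dim_\Bbbk\widetilde H_k(\,\cdot\,;\Bbbk)$. $\Pi_{m}=(\Pi_{m,1},\dots,\Pi_{m,m})$ is the ordered partition of the positive integers $\mathbb{P}$ with $\Pi_{m,i}=\{n\in\mathbb{P}: n\equiv i\pmod m\}$, with $\mathbb{P}$ in its usual order. $\binom{\Pi_m}{j}$ is the set of $j$-subsets of $\mathbb{P}$ meeting each $\Pi_{m,i}$ in at most one element; for $A,B\in\binom{\Pi_m}{j}$, $A>_{r\ell}B$ iff $\max(A\setminus B)>\max(B\setminus A)$. A complex $\Gamma$ on $\mathbb{P}$ all of whose faces lie in $\bigcup_j\binom{\Pi_m}{j}$ ($m$-colorable w.r.t. $\Pi_m$) is revlex if for every $j\in[m]$, whenever $F,F'\in\binom{\Pi_m}{j}$, $F>_{r\ell}F'$ and $F\in\Gamma$, then $F'\in\Gamma$. *)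

(* Defs.v *)
From mathcomp Require Import all_boot all_order all_algebra finmap.

Set Implicit Arguments.
Unset Strict Implicit.
Unset Printing Implicit Defensive.

Import GRing.Theory.

Local Open Scope fset_scope.

(* Finite simplicial complexes whose vertices lie in an arbitrary choiceType.
   The empty face belongs to every complex (this is the non-emptiness
   condition), so a face of cardinality n has dimension n - 1. *)
Section Complexes.
Variable K : choiceType.
Implicit Types (D : {fset {fset K}}) (A B : {fset K}).

Definition simplicial_complex D : Prop :=
  D != fset0 /\ (forall A B, A \in D -> B `<=` A -> B \in D).

Definition faces D (n : nat) : {fset {fset K}} :=
  [fset A in D | #|` A| == n].

Definition fnum D (i : nat) : nat := #|` faces D i.+1|.

Definition has_dim D (d : nat) : Prop := (\max_(A <- D) #|` A|)%N = d.+1.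

(* The case v = w of the adjacency condition says that v is a vertex of D. *)
Definition flag_complex D : Prop :=
  simplicial_complex D /\
  (forall A, (forall v w, v \in A -> w \in A -> [fset v; w] \in D) -> A \in D).

Definition vertices D : {fset K} := \bigcup_(A <- D) A.

Definition generated_complex (S : {fset {fset K}}) : {fset {fset K}} :=
  \bigcup_(A <- S) fpowerset A.

End Complexes.

(* Reduced simplicial homology.  Faces are oriented by the order in which the
   vertices are listed in the enumeration of the finite set vertices D. *)
Section Homology.
Variables (F : fieldType) (K : choiceType) (D : {fset {fset K}}).
Implicit Types (A B : {fset K}).
Local Open Scope ring_scope.

(* (-1) ^ p, where v is the p-th vertex of A, counting from 0. *)
Definition face_sign A (v : K) : F :=
  (-1) ^+ #|` [fset w in A | index w (vertices D) < index v (vertices D)]%N|.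

(* The coefficient of B in the boundary of A; at most one term is nonzero. *)
Definition incidence A B : F :=
  \sum_(v <- A | A `\ v == B) face_sign A v.

(* The matrix of the k-th boundary map of the augmented chain complex (its
   target for k = 0 is spanned by the empty face), acting on row vectors by
   multiplication on the right. *)
Definition boundary_mx (k : nat)
    : 'M[F]_(#|` faces D k.+1|, #|` faces D k|) :=
  \matrix_(i, j)
    incidence (nth fset0 (faces D k.+1) i) (nth fset0 (faces D k) j).

(* dim (ker / im); for a simplicial complex the row space of
   boundary_mx k.+1 lies in kermx (boundary_mx k), see boundary_sub_cycle. *)
Definition betti (k : nat) : nat :=
  (\rank (kermx (boundary_mx k)) - \rank (boundary_mx k.+1))%N.

Lemma index_vertices_inj A : A \in D ->
  {in A &, injective (fun v => index v (vertices D))}.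
Proof.
move=> AD; have inV x : x \in A -> x \in vertices D.
  by move=> xA; apply/bigfcupP; exists A; rewrite ?AD.
move=> v w vA wA e.
by rewrite -(nth_index v (inV _ vA)) e nth_index //; exact: inV.
Qed.

Lemma face_signD1 A v w : A \in D -> v \in A -> w \in A -> v != w ->
  face_sign A v * face_sign (A `\ v) w = - (face_sign A w * face_sign (A `\ w) v).
Proof.
move=> AD; wlog: v w / (index v (vertices D) < index w (vertices D))%N.
  move=> H vA wA vw.
  case: (ltngtP (index v (vertices D)) (index w (vertices D))) => [lt|gt|e].
  - exact: H.
  - by rewrite (H w v) // ?opprK // eq_sym.
  - by case/eqP: vw; apply: (index_vertices_inj AD).
move=> lt vA wA vw.
have -> : face_sign (A `\ w) v = face_sign A v.
  rewrite /face_sign; congr (_ ^+ #|` _|); apply/fsetP => x; rewrite !inE /=.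
  by case: (x =P w) => //= ->; rewrite ltnNge (ltnW lt) andbF.
suff -> : face_sign A w = - face_sign (A `\ v) w by rewrite mulNr opprK mulrC.
rewrite /face_sign (cardfsD1 v) !inE /= vA lt exprS mulN1r.
congr (- (_ ^+ #|` _|)); apply/fsetP => x; rewrite !inE /=.
by rewrite andbA.
Qed.

Lemma boundary_boundary k : simplicial_complex D ->
  boundary_mx k.+1 *m boundary_mx k = 0.
Proof.
case=> _ cD; apply/matrixP => i j; rewrite !mxE.
under eq_bigr => l _ do rewrite !mxE.
set C := nth fset0 (faces D k) j; set A := nth fset0 (faces D k.+2) i.
have : A \in faces D k.+2 by exact: mem_nth.
rewrite !inE /= => /andP[AD /eqP cA].
pose idx v := index v (vertices D).
pose g v w : F := if (w != v) && (A `\ v `\ w == C)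
  then face_sign A v * face_sign (A `\ v) w else 0.
have gN v w : v \in A -> w \in A -> g v w = - g w v.
  move=> vA wA; rewrite /g eq_sym fsetDDl fsetUC -fsetDDl.
  case: ifP => [/andP[vw _]|_]; last by rewrite oppr0.
  exact: face_signD1.
have -> : \sum_(l < #|` faces D k.+1|)
    incidence A (nth fset0 (faces D k.+1) l) *
    incidence (nth fset0 (faces D k.+1) l) C
  = \sum_(v <- A) \sum_(w <- A) g v w.
  rewrite -(big_mkord predT (fun l => incidence A (nth fset0 (faces D k.+1) l) *
    incidence (nth fset0 (faces D k.+1) l) C)).
  rewrite -(big_nth fset0 predT (fun B => incidence A B * incidence B C)).
  under eq_bigr => B _ do rewrite [incidence A B]/incidence big_distrl /= big_mkcond /=.
  rewrite exchange_big /=; apply: eq_big_seq => v vA.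
  have BD : A `\ v \in faces D k.+1.
    rewrite !inE /= (cD A) ?fsubsetDl //=.
    by move: cA; rewrite (cardfsD1 v) vA add1n => -[->].
  rewrite (big_fsetD1 _ BD) /= eqxx big1_seq ?addr0; last first.
    by move=> B /andP[_]; rewrite !inE eq_sym => /andP[/negbTE->].
  rewrite /incidence big_distrr /= (big_fsetD1 v vA) /=.
  rewrite {1}/g eqxx add0r big_mkcond /=; apply: eq_big_seq => w.
  by rewrite !inE /g => /andP[-> _].
have -> : \sum_(v <- A) \sum_(w <- A) g v w =
    \sum_(v <- A) \sum_(w <- A | (idx v < idx w)%N) g v w
  + \sum_(v <- A) \sum_(w <- A | (idx w < idx v)%N) g v w.
  rewrite -big_split /=; apply: eq_big_seq => v vA.
  rewrite [X in X + _]big_mkcond [X in _ + X]big_mkcond -big_split /=.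
  apply: eq_big_seq => w wA.
  case: (ltngtP (idx v) (idx w)) => [||e]; rewrite ?addr0 ?add0r //.
  by rewrite (index_vertices_inj AD vA wA e) /g eqxx.
rewrite [X in _ + X](exchange_big_dep predT) //= -big_split /= big1_seq // => v /= vA.
rewrite -big_split big1_seq // => w /andP[_ wA] /=.
by rewrite (gN v w) // addNr.
Qed.

Lemma boundary_sub_cycle k : simplicial_complex D ->
  (boundary_mx k.+1 <= kermx (boundary_mx k))%MS.
Proof. by move=> cD; apply/sub_kermxP; exact: boundary_boundary. Qed.

End Homology.

(* The class Pi_{m,i} of the partition Pi_m of the positive integers. *)
Definition Pi_class (m i : nat) : pred nat :=
  fun n => (0 < n)%N && (n == i %[mod m]).

(* Membership in the set of j-subsets of the positive integers meeting each of
   Pi_{m,1}, ..., Pi_{m,m} in at most one element. *)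
Definition rainbow (m j : nat) (A : {fset nat}) : Prop :=
  [/\ forall n, n \in A -> (0 < n)%N,
      #|` A| = j
    & forall i, (1 <= i <= m)%N -> (#|` [fset n in A | Pi_class m i n]| <= 1)%N].

(* Only meant for finite sets of positive integers of equal cardinality. If
   A = B both maxima are 0 and the relation fails, as it should. *)
Definition revlex_gt (A B : {fset nat}) : bool :=
  (\max_(b <- B `\` A) b < \max_(a <- A `\` B) a)%N.

Definition colorable_Pi (m : nat) (G : {fset {fset nat}}) : Prop :=
  forall A, A \in G -> exists j, rainbow m j A.

Definition revlex_closed (m : nat) (G : {fset {fset nat}}) : Prop :=
  forall j, (1 <= j <= m)%N ->
  forall A B, rainbow m j A -> rainbow m j B -> revlex_gt A B ->
    A \in G -> B \in G.

Definition revlex_complex (m : nat) (G : {fset {fset nat}}) : Prop :=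
  [/\ simplicial_complex G, colorable_Pi m G & revlex_closed m G].

Definition minimal_complex (P : {fset {fset nat}} -> Prop)
    (G : {fset {fset nat}}) : Prop :=
  P G /\ (forall G', P G' -> G' `<=` G -> G' = G).

(* S consists of the N smallest elements of binom(Pi_m, j). *)
Definition revlex_smallest (m j N : nat) (S : {fset {fset nat}}) : Prop :=
  [/\ #|` S| = N,
      forall A, A \in S -> rainbow m j A
    & forall A B, A \in S -> rainbow m j B -> B \notin S -> revlex_gt B A].

(* Main.v *)
(* Let b_m(N) be the number of sets among the N smallest rainbow m-sets that avoid
   the first vertex of every colour.  Replacing vertices by the first one of
   their colour fills cycles by cones, so the top boundary of the revlex complex
   has rank at most N - b_m(N), and its top Betti number is at least b_m(N).  For
   a flag complex, let v be a vertex whose link has the most facets, and delete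
   the vertices not adjacent to v one by one, until a cone over the link of v
   remains; each deletion raises the rank of the top boundary by at least the
   rank for the link.  By induction the top Betti number is at most the sum of
   b_{m-1}(n_i) over the deleted vertices, where n_i <= n_0 are the facet numbers
   of the links and n_0 + sum n_i = N.  This sum is at most b_m(N), by a purely
   numerical compression argument. *)

Require Import Defs.
From mathcomp Require Import all_boot all_order all_algebra finmap.
From mathcomp Require Import zify.

Set Implicit Arguments.
Unset Strict Implicit.
Unset Printing Implicit Defensive.

Import GRing.Theory.

(** * Enumeration of the rainbow sets *)

(** The numerical statement keeps only facet numbers. Columns [n <= n0], each read as an initial
    segment, must have together at most as many interior sets as the initial segment of their total
    size ([n0] included) with one more colour. The column [n0] is not counted on the left: it stands
    for level 0 of the added colour, which interior sets avoid; in the flag complex it is the link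
    of v, and the final cone over it has no top cycles. The obstacle is that arbitrary columns are
    not the level slices of one initial segment. A small column can be split off, but several large
    ones cannot; these are first recut along a colour of their own, whose slices are again initial
    segments. Hence the enumeration is recursive in the largest vertex, which turns slicing by any
    colour into arithmetic on positions. Ranks are attached to arbitrary families of faces, because
    the same splitting into deletion and link serves both complexes: one inequality always holds,
    the other under a shifting condition. *)

Lemma exists_max_seq (T : eqType) (s : seq T) (f : T -> nat) : s != [::] ->
  exists2 x, x \in s & forall y, y \in s -> f y <= f x.
Proof.
elim: s => // a s IH _; case: (eqVneq s [::]) => [->|/IH[x xs Hx]].
  by exists a; rewrite ?mem_head // => y; rewrite inE => /eqP ->.
have [le|lt] := leqP (f a) (f x).
  by exists x; rewrite ?inE ?xs ?orbT // => y; rewrite inE => /orP[/eqP->|/Hx].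
exists a; rewrite ?mem_head // => y; rewrite inE => /orP[/eqP-> //|/Hx le].
exact: leq_trans le (ltnW lt).
Qed.

(* Vertex v (counted from 0) has colour [v %% m] and level [v %/ m].  This is the
   number of m-sets with one vertex of each colour among the first t vertices;
   those with largest vertex t are counted by deleting it and renumbering the
   vertices of the other colours. *)
Fixpoint turan (m t : nat) : nat :=
  if m is n.+1 then \sum_(s < t) turan n (s - s %/ n.+1) else 1.

Lemma turanS m t : turan m.+1 t.+1 = turan m.+1 t + turan m (t - t %/ m.+1).
Proof. by rewrite /= big_ord_recr. Qed.

Lemma turan0 m : turan m.+1 0 = 0.
Proof. by rewrite /= big_ord0. Qed.

Lemma leq_turan m s t : s <= t -> turan m s <= turan m t.
Proof.
case: m => // m /subnK <-; elim: (t - s) => // k IH.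
by rewrite addSn turanS (leq_trans IH) ?leq_addr.
Qed.

Lemma leq_sub_div m s t : s <= t -> s - s %/ m.+1 <= t - t %/ m.+1.
Proof.
move=> /subnK <-; elim: (t - s) => // k IH; apply: leq_trans IH _.
rewrite addSn; set u := k + s; have := leq_div u m.+1.
have : u.+1 %/ m.+1 <= (u %/ m.+1).+1.
  by rewrite -ltnS ltn_divLR // !mulSn; move: (ltn_ceil u (ltn0Sn m)); rewrite mulSn; lia.
lia.
Qed.

Lemma turan_small m t : t < m -> turan m t = 0.
Proof.
elim: m t => // m IH t ltt; rewrite /= big1 // => -[s /= lts] _.
by rewrite IH //; apply: leq_ltn_trans (leq_subr _ _) _; lia.
Qed.

Lemma turan_self m : turan m m = 1.
Proof.
by elim: m => // m IH; rewrite turanS divn_small // subn0 IH turan_small.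
Qed.

Lemma turan_gt0 m t : m <= t -> 0 < turan m t.
Proof. by move=> /(leq_turan m); rewrite turan_self. Qed.

Lemma turan_unbounded m N : exists t, N < turan m.+1 t.+1.
Proof.
exists (N + m); elim: N => [|N IH]; first by rewrite turan_self.
rewrite addSn turanS; apply: leq_ltn_trans IH _; rewrite -{1}[turan _ _]addn0 ltn_add2l.
apply: turan_gt0.
apply: (@leq_trans (m.+1 - m.+1 %/ m.+1)); first by rewrite divnn /= subn1.
by apply: leq_sub_div; rewrite ltnS leq_addl.
Qed.

Definition top_vertex m N := ex_minn (turan_unbounded m N).

Lemma top_vertexP m N :
  turan m.+1 (top_vertex m N) <= N < turan m.+1 (top_vertex m N).+1.
Proof.
rewrite /top_vertex; case: ex_minnP => t -> tmin; rewrite andbT leqNgt.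
apply/negP => lt; case: t tmin lt => [|t] tmin; first by rewrite turan0.
by move=> /tmin; rewrite ltnn.
Qed.

Lemma top_vertexE m t y : y < turan m (t - t %/ m.+1) ->
  top_vertex m (turan m.+1 t + y) = t.
Proof.
move=> lty; have /andP[le lt] := top_vertexP m (turan m.+1 t + y).
move: le lt; set u := top_vertex _ _ => le lt.
have ltT : turan m.+1 t + y < turan m.+1 t.+1 by rewrite turanS ltn_add2l.
apply/eqP; rewrite eqn_leq; apply/andP; split; rewrite leqNgt; apply/negP => /(leq_turan m.+1).
  by move=> h; move: (leq_trans ltT h); lia.
by move=> h; move: (leq_trans lt h); lia.
Qed.

(* Adds colour e, at level l, to a tuple of levels on the other colours. *)
Definition insert_at (e l : nat) (f : nat -> nat) (c : nat) : nat :=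
  if c == e then l else f (unbump e c).

(* The N-th rainbow m-set in revlex order, as the function from colours to levels;
   only [tup 0 0] is meaningful for m = 0. *)
Fixpoint tup (m N : nat) : nat -> nat :=
  if m is n.+1 then
    let t := top_vertex n N in
    insert_at (t %% n.+1) (t %/ n.+1) (tup n (N - turan n.+1 t))
  else fun=> 0.

(** Sets with largest vertex [t] occupy the positions from [turan m.+1 t] on, ordered as the sets
    left after deleting that vertex. *)
Lemma tupE m t y : y < turan m (t - t %/ m.+1) ->
  tup m.+1 (turan m.+1 t + y) = insert_at (t %% m.+1) (t %/ m.+1) (tup m y).
Proof. by move=> lty; rewrite /= top_vertexE // addKn. Qed.

Lemma tup_blockP m N : exists t y, [/\ N = turan m.+1 t + y & y < turan m (t - t %/ m.+1)].
Proof.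
have /andP[le lt] := top_vertexP m N.
exists (top_vertex m N), (N - turan m.+1 (top_vertex m N)); split; first by rewrite subnKC.
by rewrite ltn_subLR // -turanS.
Qed.

Lemma sum_tup_block m t y (h : (nat -> nat) -> nat) : y <= turan m (t - t %/ m.+1) ->
  \sum_(k < turan m.+1 t + y) h (tup m.+1 k) =
  \sum_(k < turan m.+1 t) h (tup m.+1 k)
  + \sum_(k < y) h (insert_at (t %% m.+1) (t %/ m.+1) (tup m k)).
Proof.
move=> ley; rewrite big_split_ord; congr (_ + _); apply: eq_bigr => -[k /= ltk] _.
by congr (h _); exact: tupE (leq_trans ltk ley).
Qed.

(** * Interior sets and slices of initial segments by one colour *)

Definition all_pos m (f : nat -> nat) := [forall c : 'I_m, 0 < f c].

(* Among the first x rainbow m-sets, those avoiding the lowest vertex of every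
   colour; by convention [interior 0] is the identity. *)
Definition interior (m x : nat) : nat := \sum_(k < x) all_pos m (tup m k).

Definition slice (m c j x : nat) : nat := \sum_(k < x) (tup m k c == j).

(* Number of vertices of colour c among the first t, for m.+1 colours. *)
Definition level_count (m c t : nat) : nat := t %/ m.+1 + (c < t %% m.+1).

Lemma leq_sum_ord (h : nat -> nat) x y : x <= y -> \sum_(k < x) h k <= \sum_(k < y) h k.
Proof.
by move=> /subnK <-; rewrite addnC big_split_ord leq_addr.
Qed.

Lemma leq_slice m c j x y : x <= y -> slice m c j x <= slice m c j y.
Proof. exact: (@leq_sum_ord (fun k => tup m k c == j)). Qed.

Lemma unbump_lt e c m : c < m.+1 -> e < m.+1 -> c != e -> unbump e c < m.
Proof. by rewrite /unbump => *; lia. Qed.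

Lemma slice_block m c j t y : y <= turan m (t - t %/ m.+1) ->
  slice m.+1 c j (turan m.+1 t + y) = slice m.+1 c j (turan m.+1 t) +
  (if c == t %% m.+1 then (t %/ m.+1 == j) * y else slice m (unbump (t %% m.+1) c) j y).
Proof.
move=> ley; rewrite /slice (@sum_tup_block m t y (fun f => f c == j)) //; congr (_ + _).
rewrite /insert_at; case: ifP => // _.
by rewrite sum_nat_const card_ord mulnC.
Qed.

Lemma level_countS m c t : c <= m -> level_count m c t.+1 = level_count m c t + (c == t %% m.+1).
Proof.
move=> lecm; rewrite /level_count.
have := divn_eq t m.+1; set l := t %/ _; set e := t %% _ => dt.
have lte : e < m.+1 by exact: ltn_pmod.
have [eqe|nee] := eqVneq e m.
  have -> : t.+1 = l.+1 * m.+1 by rewrite dt eqe mulSn; lia.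
  rewrite mulnK // modnMl; lia.
have -> : t.+1 = l * m.+1 + e.+1 by lia.
rewrite divnMDl // modnMDl divn_small ?modn_small //; lia.
Qed.

Lemma leq_level_count m c s t : c <= m -> s <= t -> level_count m c s <= level_count m c t.
Proof.
move=> lecm /subnK <-; elim: (t - s) => // k IH.
by rewrite addSn level_countS // (leq_trans IH) ?leq_addr.
Qed.

Lemma level_count_unbump m c t : c <= m.+1 -> c != t %% m.+2 ->
  level_count m (unbump (t %% m.+2) c) (t - t %/ m.+2) = level_count m.+1 c t.
Proof.
move=> lecm; rewrite /level_count.
have := divn_eq t m.+2; set l := t %/ _; set e := t %% _ => dt nece.
have lte : e < m.+2 by exact: ltn_pmod.
have -> : t - l = l * m.+1 + e by rewrite dt !mulnS; lia.
rewrite divnMDl // modnMDl.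
have [eqe|nee] := eqVneq e m.+1.
  by rewrite eqe divnn modnn /= /unbump; lia.
rewrite divn_small ?modn_small /unbump; lia.
Qed.

(* Restricting a box to one level of colour c leaves the box on the other colours. *)
Lemma slice_turan m c j t : c <= m ->
  slice m.+1 c j (turan m.+1 t) = if j < level_count m c t then turan m (t - level_count m c t) else 0.
Proof.
elim: m c t => [|m IHm] c t lecm; elim: t => [|t IHt].
1,3: by rewrite turan0 /slice big_ord0 /level_count div0n mod0n ltn0.
- rewrite turanS slice_block // IHt level_countS //.
  case: c lecm IHt => // _ IHt; rewrite /level_count !modn1 !divn1 eqxx /= !addn0 addn1 ltnS muln1.
  by case: ltngtP.
rewrite turanS slice_block // IHt level_countS //; case: eqP => [->|/eqP nece].
  have := divn_eq t m.+2; set l := t %/ _; set e := t %% _ => dt.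
  have -> : level_count m.+1 e t = l by rewrite /level_count ltnn addn0.
  rewrite addn1 subSS ltnS; case: (ltngtP j l) => [ltjl|gtjl|_].
  - by rewrite mul0n addn0.
  - by rewrite mul0n.
  by rewrite mul1n.
rewrite addn0; rewrite IHm; last first.
  by rewrite -ltnS; apply: unbump_lt => //; exact: ltn_pmod.
rewrite level_count_unbump //; case: ltnP => // _.
have := divn_eq t m.+2; rewrite /level_count; set l := t %/ _; set e := t %% _ => dt.
have lte : e < m.+2 by exact: ltn_pmod.
have lel : l + (c < e) <= t by rewrite dt mulnS; lia.
rewrite subSn // turanS; congr (_ + turan _ _).
have -> : t - (l + (c < e)) = l * m.+1 + unbump c e.
  by rewrite dt /unbump mulnS; lia.
rewrite divnMDl // divn_small ?addn0; last by apply: unbump_lt => //; rewrite eq_sym.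
by rewrite dt /unbump mulnS; lia.
Qed.

Lemma tup_lt_level_count m k t c : c <= m -> k < turan m.+1 t -> tup m.+1 k c < level_count m c t.
Proof.
move=> lecm ltk; rewrite ltnNge; apply/negP => le.
have := slice_turan (tup m.+1 k c) t lecm; rewrite ltnNge le /= => /eqP.
by rewrite /slice sum_nat_eq0 => /forallP /(_ (Ordinal ltk)) /=; rewrite eqxx.
Qed.

Lemma tup_vertex_lt m k t c : c <= m -> k < turan m.+1 t -> tup m.+1 k c * m.+1 + c < t.
Proof.
move=> lecm /(tup_lt_level_count lecm); rewrite /level_count => lt.
have dt := divn_eq t m.+1; have lte : t %% m.+1 < m.+1 by exact: ltn_pmod.
have [ltl|gel] := ltnP (tup m.+1 k c) (t %/ m.+1).
  by rewrite dt -addnS; move: ltl; rewrite -(leq_pmul2r (ltn0Sn m)) mulSn; lia.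
rewrite dt; have -> : tup m.+1 k c = t %/ m.+1 by lia.
by rewrite ltn_add2l; lia.
Qed.

Lemma turan_level_count m c t : c <= m -> turan m.+1 t = level_count m c t * turan m (t - level_count m c t).
Proof.
move=> lecm; set q := level_count m c t.
have -> : turan m.+1 t = \sum_(j < q) slice m.+1 c j (turan m.+1 t).
  rewrite exchange_big /= -[LHS]card_ord -sum1_card; apply: eq_bigr => -[k /= ltk] _.
  rewrite (bigD1 (Ordinal (tup_lt_level_count lecm ltk))) //= eqxx big1 // => j.
  by rewrite -val_eqE /= eq_sym => /negbTE ->.
under eq_bigr => j _ do rewrite slice_turan // ltn_ord.
by rewrite sum_nat_const card_ord.
Qed.

(* The tuples with a given entry at colour c are listed, with that entry
   deleted, in the same order as all tuples on one colour less. *)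
Lemma tup_bump m c N i : c <= m -> i < m ->
  tup m.+1 N (bump c i) = tup m (slice m.+1 c (tup m.+1 N c) N) i.
Proof.
elim: m c N i => // m IHm c N i lecm ltim.
have [t [y [-> lty]]] := tup_blockP m.+1 N.
rewrite tupE // slice_block ?(ltnW lty) // slice_turan // /insert_at.
have := divn_eq t m.+2; set l := t %/ _ in lty *; set e := t %% _ => dt.
have lte : e < m.+2 by exact: ltn_pmod.
case: (eqVneq c e) => [->|nece].
  by rewrite eqxx /level_count ltnn addn0 ltnn add0n mul1n eq_sym (negbTE (neq_bump _ _)) bumpK.
set c' := unbump e c; set j := tup m.+1 y c'.
have lec' : c' <= m by rewrite -ltnS; exact: unbump_lt.
have ltj : j < level_count m c' (t - l) by exact: tup_lt_level_count.
have dlev : level_count m c' (t - l) = level_count m.+1 c t by exact: level_count_unbump.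
rewrite -dlev ltj dlev.
have dt1 : t - level_count m.+1 c t = l * m.+1 + unbump c e.
  by rewrite /level_count -/l -/e dt /unbump mulnS; lia.
have ltu : unbump c e < m.+1 by apply: unbump_lt => //; rewrite eq_sym.
(* The set at position [y] itself has level [j], so fewer sets of level [j] precede it than the
   whole box contains. *)
have ltsl : slice m.+1 c' j y < turan m (t - level_count m.+1 c t - (t - level_count m.+1 c t) %/ m.+1).
  have -> : (t - level_count m.+1 c t) %/ m.+1 = l by rewrite dt1 divnMDl // divn_small // addn0.
  have -> : t - level_count m.+1 c t - l = t - l - level_count m c' (t - l) by rewrite dlev; lia.
  have <- : slice m.+1 c' j (turan m.+1 (t - l)) = turan m (t - l - level_count m c' (t - l)).
    by rewrite slice_turan // ltj.
  apply: leq_trans (leq_slice _ _ _ lty).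
  by rewrite /slice big_ord_recr /= eqxx addn1.
rewrite tupE // /insert_at dt1 modnMDl divnMDl // modn_small // divn_small // addn0.
have -> : (bump c i == e) = (i == unbump c e) by rewrite /bump /unbump; lia.
case: eqP => // /eqP nei.
have -> : unbump e (bump c i) = bump c' (unbump (unbump c e) i).
  rewrite /c' /bump /unbump; clear -nece nei ltu; move: nei; rewrite /unbump.
  by case: (ltngtP c e) nece => // ? _; case: (leqP c i) => ?; lia.
by rewrite IHm // ; apply: unbump_lt.
Qed.

(** In a full box all levels present are equally frequent. A partial block at level [l > 0] of
    colour [c] adds [y] sets to a level still empty, and [y] is at most the size of the full level
    0. *)
Lemma slice_leq0 m c j x : c <= m -> slice m.+1 c j x <= slice m.+1 c 0 x.
Proof.
elim: m c x => [|m IHm] c x lecm.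
- have [t [y [-> lty]]] := tup_blockP 0 x.
  rewrite !slice_block ?(ltnW lty) // !slice_turan //.
  case: c lecm => // _; rewrite /level_count modn1 divn1 eqxx /=; rewrite !addn0.
  by case: y lty => // _; rewrite !muln0 !addn0; case: ltnP => // /(leq_ltn_trans _) ->.
have [t [y [-> lty]]] := tup_blockP m.+1 x.
rewrite !slice_block ?(ltnW lty) // !slice_turan //.
case: eqP => [->|/eqP nece]; last first.
  apply: leq_add; last by apply: IHm; rewrite -ltnS; apply: unbump_lt => //; exact: ltn_pmod.
  by case: ifP => // /(leq_ltn_trans _) ->.
rewrite /level_count ltnn addn0; move: lty; set l := t %/ _ => lty.
case: (ltngtP j l) => [ltj|gtj|_]; rewrite ?mul0n ?addn0 ?mul1n.
- by rewrite (leq_ltn_trans _ ltj) // leq_addr.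
- by [].
by case: l lty => [|l] lty; rewrite ?mul1n //= addn0 ltnW.
Qed.

Lemma all_pos_bump m c f : c <= m ->
  all_pos m.+1 f = (0 < f c) && all_pos m (f \o bump c).
Proof.
move=> lecm; apply/forallP/andP => [H|[Hc /forallP H] i].
  split; first by have := H (inord c); rewrite inordK.
  by apply/forallP => i /=; exact: (H (lift (Ordinal (lecm : c < m.+1)) i)).
case: (unliftP (Ordinal (lecm : c < m.+1)) i) => [j|] -> //; exact: H.
Qed.

Lemma eq_all_pos m f g : (forall i, i < m -> f i = g i) -> all_pos m f = all_pos m g.
Proof. by move=> fg; apply: eq_forallb => i; rewrite fg. Qed.

Lemma interior_insert m t k :
  all_pos m.+1 (insert_at (t %% m.+1) (t %/ m.+1) (tup m k)) = (m < t) && all_pos m (tup m k).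
Proof.
have lte : t %% m.+1 < m.+1 by exact: ltn_pmod.
rewrite (all_pos_bump (c := t %% m.+1)) // /insert_at eqxx divn_gt0 //; congr (_ && _).
by apply: eq_all_pos => i _ /=; rewrite eq_sym (negbTE (neq_bump _ _)) bumpK.
Qed.

Lemma interior0x x : interior 0 x = x.
Proof.
rewrite /interior -[RHS]card_ord -sum1_card; apply: eq_bigr => k _.
by have -> : all_pos 0 (tup 0 k) by apply/forallP => -[].
Qed.

Lemma interiorx0 m : interior m 0 = 0.
Proof. by rewrite /interior big_ord0. Qed.

Lemma interior_block0 m t y : y <= turan m (t - t %/ m.+1) ->
  interior m.+1 (turan m.+1 t + y) = interior m.+1 (turan m.+1 t) + (m < t) * interior m y.
Proof.
move=> ley; rewrite /interior (@sum_tup_block m t y (all_pos m.+1)) //; congr (_ + _).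
by rewrite big_distrr /=; apply: eq_bigr => k _; rewrite interior_insert mulnb.
Qed.

Lemma interiorx1 m : interior m.+1 1 = 0.
Proof.
have := @interior_block0 m m 1; rewrite (@turan_small m.+1 m) // divn_small // subn0 turan_self => -> //.
by rewrite ltnn addn0 interiorx0.
Qed.

Lemma interior_block m t y : y <= turan m.+1 (t - t %/ m.+2) ->
  interior m.+2 (turan m.+2 t + y) = interior m.+2 (turan m.+2 t) + interior m.+1 y.
Proof.
move=> ley; rewrite interior_block0 //; case: (ltngtP m.+1 t) => [|ltt|et]; rewrite ?mul1n //.
  move: ley; rewrite turan_small ?leqn0 => [/eqP->|]; first by rewrite !interiorx0 muln0.
  exact: leq_ltn_trans (leq_subr _ _) _.
move: ley; rewrite -et divn_small // subn0 turan_self.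
by case: y => [|[|//]] _; rewrite ?interiorx0 ?interiorx1.
Qed.

Lemma turan1 t : turan 1 t = t.
Proof. by rewrite /= sum_nat_const card_ord muln1. Qed.

Lemma interior1 x : interior 1 x = x.-1.
Proof.
elim: x => [|x IH]; first by rewrite interiorx0.
have := @interior_block0 0 x 1; rewrite turan1 addn1 => -> //.
rewrite IH interior0x muln1. by case: x {IH} => // x; rewrite addn1.
Qed.

Lemma slice_sum m c L x : c <= m -> (forall k, k < x -> tup m.+1 k c <= L) ->
  \sum_(j < L.+1) slice m.+1 c j x = x.
Proof.
move=> lecm bnd; rewrite exchange_big /= -[RHS]card_ord -sum1_card.
apply: eq_bigr => -[k /= ltk] _; have lt : tup m.+1 k c < L.+1 by exact: bnd.
rewrite (bigD1 (Ordinal lt)) //= eqxx big1 // => j.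
by rewrite -val_eqE /= eq_sym => /negbTE ->.
Qed.

(** By [tup_bump] each slice is an initial segment in one colour less; level 0 contributes no
    interior set. *)
Lemma interior_slice m c L x : c <= m -> (forall k, k < x -> tup m.+1 k c <= L) ->
  interior m.+1 x = \sum_(j < L) interior m (slice m.+1 c j.+1 x).
Proof.
move=> lecm; elim: x => [|x IH] bnd.
  by rewrite interiorx0 big1 // => j _; rewrite /slice big_ord0 interiorx0.
rewrite /interior big_ord_recr /= -/(interior _ _) IH; last by move=> k /ltnW; exact: bnd.
rewrite (all_pos_bump _ lecm) -/(tup m.+1 x).
have -> : all_pos m (tup m.+1 x \o bump c) = all_pos m (tup m (slice m.+1 c (tup m.+1 x c) x)).
  by apply: eq_all_pos => i ltim /=; rewrite -tup_bump.
have sl j : slice m.+1 c j x.+1 = slice m.+1 c j x + (tup m.+1 x c == j).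
  by rewrite /slice big_ord_recr.
under [in RHS]eq_bigr => j _ do rewrite sl.
have := bnd x (ltnSn x); case E: (tup m.+1 x c) => [|j0] lej.
  by rewrite addn0; apply: eq_bigr => j _; rewrite addn0.
rewrite (bigD1 (Ordinal lej)) //= [RHS](bigD1 (Ordinal lej)) //= eqxx addn1.
rewrite /interior [in RHS]big_ord_recr /= -!addnA; congr (_ + _); rewrite addnC; congr (_ + _).
apply: eq_bigr => j; rewrite -val_eqE /= eqSS eq_sym => /negbTE ->; by rewrite addn0.
Qed.

(** * Numerical inequalities *)

Lemma leq_top_vertex m x y : x <= y -> top_vertex m x <= top_vertex m y.
Proof.
move=> lexy; have /andP[le _] := top_vertexP m x; have /andP[_ lt] := top_vertexP m y.
rewrite leqNgt; apply/negP => /(leq_turan m.+1); lia.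
Qed.

(* The last incomplete block of the smaller y is moved to the end of x; both are
   initial segments of blocks in one colour less. *)
Lemma interior_exchange m s x y : x <= turan m s -> y <= turan m s ->
  interior m x + interior m y <=
  interior m (minn (turan m s) (x + y)) + interior m (x + y - turan m s).
Proof.
elim: m s x y => [|m IHm] s x y; first by rewrite !interior0x /= => *; lia.
case: m IHm => [|m] IHm; first by rewrite !interior1 turan1 => *; lia.
wlog: x y / y <= x => [H lex ley|].
  by case: (leqP y x) => [|/ltnW] le; [exact: H | rewrite addnC (addnC x); exact: H].
have [n] := ubnP y; elim: n x y => // n IHn x y ltyn leyx lex _.
case: (posnP y) => [->|y0]; first by rewrite interiorx0 !addn0 (minn_idPr lex) leq_addr.
have [->|nex] := eqVneq x (turan m.+2 s).
  by rewrite (minn_idPl (leq_addr _ _)) addKn.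
have {nex} ltx : x < turan m.+2 s by rewrite ltn_neqAle nex.
(* The shift in [y.-1] makes the last block of [y] non-empty, while [x] itself makes block [u]
   incomplete. Hence the exchange strictly decreases [y]. *)
set u := top_vertex m.+1 x; set v := top_vertex m.+1 y.-1.
have /andP[leu ltu] := top_vertexP m.+1 x.
have /andP[lev ltv] := top_vertexP m.+1 y.-1.
have levu : v <= u by apply: leq_top_vertex; lia.
rewrite -/u -/v !turanS in leu ltu lev ltv.
have ltus : u < s.
  rewrite ltnNge; apply/negP => /(leq_turan m.+2); lia.
have leT : turan m.+1 (v - v %/ m.+2) <= turan m.+1 (u - u %/ m.+2).
  exact/leq_turan/leq_sub_div.
have := leq_turan m.+2 ltus; rewrite turanS.
set Tu := turan m.+2 u in leu ltu *; set Tu' := turan m.+1 (u - _) in ltu leT * => leTs.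
set Tv := turan m.+2 v in lev ltv *; set Tv' := turan m.+1 (v - _) in ltv leT *.
pose x' := x - Tu; pose y' := y - Tv.
have ex : x = Tu + x' by rewrite /x'; lia.
have ey : y = Tv + y' by rewrite /y'; lia.
have := IHm (u - u %/ m.+2) x' y'; rewrite -/Tu' => /(_ ltac:(lia) ltac:(lia)) H.
have b1 : interior m.+2 x = interior m.+2 Tu + interior m.+1 x'.
  by rewrite ex; apply: interior_block; rewrite -/Tu'; lia.
have b2 : interior m.+2 y = interior m.+2 Tv + interior m.+1 y'.
  by rewrite ey; apply: interior_block; rewrite -/Tv'; lia.
have b3 : interior m.+2 (Tu + minn Tu' (x' + y')) =
    interior m.+2 Tu + interior m.+1 (minn Tu' (x' + y')).
  by apply: interior_block; rewrite -/Tu' geq_minl.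
have b4 : interior m.+2 (Tv + (x' + y' - Tu')) =
    interior m.+2 Tv + interior m.+1 (x' + y' - Tu').
  by apply: interior_block; rewrite -/Tv'; lia.
have := IHn (Tu + minn Tu' (x' + y')) (Tv + (x' + y' - Tu')).
have -> : Tu + minn Tu' (x' + y') + (Tv + (x' + y' - Tu')) = x + y by lia.
move=> /(_ ltac:(lia) ltac:(lia) ltac:(lia) ltac:(lia)); rewrite b3 b4 b1 b2; lia.
Qed.

(** Number of sets with largest vertex [t.-1]: the facets in the link of the last vertex of the box
    on [t] vertices. *)
Definition last_link m t := turan m.+1 t - turan m.+1 t.-1.

(** If [x] fits into the remainder beyond the full box, both parts merge inside the current block.
    Otherwise [N - x] ends inside the last block of the box, and an exchange with [x] refills that
    block and leaves exactly the remainder. *)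
Lemma interior_split m t N x : turan m.+2 t <= N < turan m.+2 t.+1 ->
  x <= maxn (last_link m.+1 t) (N - turan m.+2 t) ->
  interior m.+2 (N - x) + interior m.+1 x <= interior m.+2 N.
Proof.
rewrite turanS => /andP[leN ltN] lex.
set T' := turan m.+1 (t - _) in ltN.
pose N' := N - turan m.+2 t; have eN : N = turan m.+2 t + N' by rewrite /N'; lia.
have bN : interior m.+2 N = interior m.+2 (turan m.+2 t) + interior m.+1 N'.
  by rewrite eN; apply: interior_block; rewrite -/T'; lia.
have [lexN|ltNx] := leqP x N'.
  have bNx : interior m.+2 (N - x) = interior m.+2 (turan m.+2 t) + interior m.+1 (N' - x).
    have -> : N - x = turan m.+2 t + (N' - x) by lia.
    by apply: interior_block; rewrite -/T'; lia.
  have := @interior_exchange m.+1 (t - t %/ m.+2) (N' - x) x; rewrite -/T'.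
  move=> /(_ ltac:(lia) ltac:(lia)).
  have -> : minn T' (N' - x + x) = N' by lia.
  have -> : N' - x + x - T' = 0 by lia.
  rewrite interiorx0; lia.
have {lex} lex : x <= last_link m.+1 t by move: lex; rewrite -/N'; lia.
case: t @T' N' eN bN leN ltN lex ltNx => [|t] T' N' eN bN leN ltN.
  by rewrite /last_link subnn; lia.
rewrite /last_link turanS addKn => lex ltNx.
set T'' := turan m.+1 _ in lex.
rewrite turanS -/T'' in eN.
have bNx : interior m.+2 (N - x) = interior m.+2 (turan m.+2 t) + interior m.+1 (T'' + N' - x).
  have -> : N - x = turan m.+2 t + (T'' + N' - x) by lia.
  by apply: interior_block; rewrite -/T''; lia.
have bT : interior m.+2 (turan m.+2 t.+1) = interior m.+2 (turan m.+2 t) + interior m.+1 T''.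
  by rewrite turanS; apply: interior_block.
have := @interior_exchange m.+1 (t - t %/ m.+2) (T'' + N' - x) x; rewrite -/T''.
move=> /(_ ltac:(lia) ltac:(lia)).
have -> : minn T'' (T'' + N' - x + x) = T'' by lia.
have -> : T'' + N' - x + x - T'' = N' by lia.
lia.
Qed.

(** [n0] plays the part of level 0 of the added colour, so it enters the total but not the left-hand
    sum. *)
Definition columns_bound m n0 s :=
  \sum_(n <- s) interior m n <= interior m.+1 (n0 + \sum_(n <- s) n).

Lemma slice_le_sub m c j u x : c <= m -> level_count m c u <= j -> turan m.+1 u <= x ->
  slice m.+1 c j x <= x - turan m.+1 u.
Proof.
move=> lecm lej /subnKC {1}<-; rewrite /slice big_split_ord /= -/(slice m.+1 c _ _).
rewrite slice_turan // ltnNge lej add0n.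
set y := x - _; rewrite -[X in _ <= X]card_ord -sum1_card.
by apply: leq_sum => k _; exact: leq_b1.
Qed.

(* Recutting the columns along the colour of the last vertex used by the
   largest one. *)
Lemma recut m n0 s u :
  (forall n1 s1, all (fun n => n <= n1) s1 -> columns_bound m n1 s1) ->
  turan m.+1 u < n0 -> all (fun n => n <= n0) s ->
  exists p0 p,
  [/\ all (fun n => 0 < n <= p0) p, p0 + \sum_(n <- p) n = n0 + \sum_(n <- s) n,
      columns_bound m.+1 p0 p -> columns_bound m.+1 n0 s,
      u %/ m.+1 <= size p
    & all (fun n => turan m.+1 u <= n) s ->
      last p0 p <= \sum_(n <- n0 :: s) (n - turan m.+1 u)].
Proof.
move=> IHm ltun les.
have n00 : 0 < n0 by exact: leq_ltn_trans ltun.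
(* Positions start at 0, so [n0.-1] is the last set of the largest column and [v] its largest
   vertex; no column reaches beyond level [L] of colour [c]. *)
set v := top_vertex m n0.-1; set c := v %% m.+1; set L := v %/ m.+1.
have lecm : c <= m by rewrite -ltnS ltn_pmod.
have /andP[lev ltv] := top_vertexP m n0.-1; rewrite -/v in lev ltv.
have leuv : u <= v.
  rewrite leqNgt; apply/negP => /(leq_turan m.+1); lia.
have levv : level_count m c v = L by rewrite /level_count ltnn addn0.
pose P j := \sum_(n <- n0 :: s) slice m.+1 c j n.
have bnd n : n <= n0 -> forall k, k < n -> tup m.+1 k c <= L.
  move=> len k ltk; have /(tup_lt_level_count lecm) : k < turan m.+1 v.+1 by lia.
  by rewrite level_countS // levv eqxx addn1.
have les0 : all (fun n => n <= n0) (n0 :: s) by rewrite /= leqnn.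
have sumP : \sum_(j < L.+1) P j = n0 + \sum_(n <- s) n.
  rewrite exchange_big /= -(big_cons _ _ n0 s xpredT id) /=.
  by apply: eq_big_seq => n /(allP les0) len; rewrite slice_sum //; exact: bnd.
have szp : size [seq P j | j <- iota 1 L] = L by rewrite size_map size_iota.
have bigp (h : nat -> nat) : \sum_(n <- [seq P j | j <- iota 1 L]) h n = \sum_(j < L) h (P j.+1).
  have -> : iota 1 L = index_iota 1 L.+1 by rewrite /index_iota subn1.
  by rewrite big_map big_add1 /= big_mkord.
have posP j : j <= L -> 0 < slice m.+1 c j n0.
  rewrite leq_eqVlt => /orP[/eqP ->|ltj].
    have -> : n0 = n0.-1.+1 by rewrite prednK.
    suff : tup m.+1 n0.-1 c = L by rewrite /slice big_ord_recr /= => ->; rewrite eqxx addn1.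
    by rewrite /= -/v /insert_at eqxx.
  have le1 : turan m.+1 v <= n0 by lia.
  apply: leq_trans (leq_slice _ _ _ le1); rewrite slice_turan // levv ltj.
  move: ltv; rewrite turanS -/L; lia.
exists (P 0), [seq P j | j <- iota 1 L]; split.
- apply/allP => x /mapP[j]; rewrite mem_iota add1n ltnS => /andP[j0 lej] -> {x}.
  apply/andP; split; last by apply: leq_sum => n _; exact: slice_leq0.
  by rewrite /P big_cons addn_gt0 posP.
- by rewrite bigp -sumP big_ord_recl.
- rewrite /columns_bound !bigp => H.
  have -> : n0 + \sum_(n <- s) n = P 0 + \sum_(j < L) P j.+1 by rewrite -sumP big_ord_recl.
  apply: leq_trans H.
  have -> : \sum_(n <- s) interior m.+1 n =
    \sum_(j < L) \sum_(n <- s) interior m (slice m.+1 c j.+1 n).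
    rewrite exchange_big /=; apply: eq_big_seq => n /(allP les) len.
    by apply: interior_slice => //; exact: bnd.
  apply: leq_sum => j _.
  (* On a fixed level the slices of [n0] and of [s] are again columns, with the slice of [n0] the
     largest. *)
  have := IHm (slice m.+1 c j.+1 n0) [seq slice m.+1 c j.+1 n | n <- s].
  rewrite /columns_bound !big_map /P big_cons; apply.
  by rewrite all_map; apply/allP => n /(allP les) /= len; exact: leq_slice.
- by rewrite szp leq_div2r.
move=> geu; have -> : last (P 0) [seq P j | j <- iota 1 L] = P L.
  have -> : [seq P j | j <- iota 1 L] = behead [seq P j | j <- iota 0 L.+1] by [].
  rewrite -[P 0]/(head 0 [seq P j | j <- iota 0 L.+1]).
  have -> : last (head 0 [seq P j | j <- iota 0 L.+1]) (behead [seq P j | j <- iota 0 L.+1])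
     = last 0 [seq P j | j <- iota 0 L.+1] by [].
  by rewrite -addn1 iotaD map_cat last_cat.
rewrite /P !big_cons.
have leL : level_count m c u <= L by rewrite -levv leq_level_count.
apply: leq_add; first by apply: slice_le_sub => //; exact: ltnW.
rewrite big_seq [X in _ <= X]big_seq; apply: leq_sum => n /(allP geu) le.
exact: slice_le_sub.
Qed.

Lemma sum_ge_size (s : seq nat) M : all (fun n => M <= n) s -> size s * M <= \sum_(n <- s) n.
Proof.
elim: s => [|n s IH] /=; first by rewrite big_nil.
by rewrite big_cons mulSn => /andP[le /IH]; exact: leq_add.
Qed.

Lemma sum_subn (s : seq nat) M : all (fun n => M <= n) s ->
  \sum_(n <- s) (n - M) = \sum_(n <- s) n - size s * M.
Proof.
elim: s => [|n s IH] /=; first by rewrite !big_nil.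
by rewrite !big_cons mulSn => /andP[le /[dup]/sum_ge_size + /IH ->]; lia.
Qed.

(* A column not exceeding the larger of the last link and the remainder is
   removed by [interior_split].  If there is none, there are at most q columns,
   q being the number of levels of the last colour, and recutting makes their
   number exactly q; recutting once more, the last column only consists of sets
   beyond the full box, of which there are too few. *)
Lemma interior_columns m n0 s : all (fun n => n <= n0) s -> columns_bound m n0 s.
Proof.
elim: m n0 s => [|m IHm] n0 s.
  (* With one colour only the first set is not interior, and a non-zero [n0] makes up for it. *)
  rewrite /columns_bound interior1; under eq_bigr do rewrite interior0x.
  case: n0 => [|n0] le; last by rewrite addSn /= leq_addl.
  by rewrite big_seq big1 // => n /(allP le); rewrite leqn0 => /eqP.
have [B] := ubnP (n0 + \sum_(n <- s) n); elim: B n0 s => // B IHB n0 s.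
rewrite ltnS => leB les; set N := n0 + _ in leB.
have /andP[leN ltN] := top_vertexP m.+1 N; set t := top_vertex m.+1 N in leN ltN.
set M := maxn (last_link m.+1 t) (N - turan m.+2 t).
have step n1 s1 : n1 + \sum_(n <- s1) n = N -> all (fun n => n <= n1) s1 ->
    has (fun n => 0 < n <= M) s1 -> columns_bound m.+1 n1 s1.
  move=> eN les1 /hasP[n ns1 /andP[n_gt0 leM]]; rewrite /columns_bound eN.
  have rem_sum (h : nat -> nat) : \sum_(k <- s1) h k = h n + \sum_(k <- rem n s1) h k.
    exact: big_rem.
  rewrite rem_sum; rewrite (rem_sum id) /= in eN.
  have leNn : n <= N by rewrite -eN addnCA leq_addr.
  have := @interior_split m t N n; rewrite leN ltN => /(_ isT leM).
  have := IHB n1 (rem n s1); rewrite /columns_bound.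
  have -> : n1 + \sum_(y <- rem n s1) y = N - n by rewrite -eN addnCA addKn.
  have les1' : all (fun n => n <= n1) (rem n s1).
    by apply/allP => k /mem_rem /(allP les1).
  have ltB : N - n < B by apply: leq_trans leB; rewrite ltn_subrL n_gt0 (leq_trans n_gt0).
  move=> /(_ ltB les1') H1; apply: leq_trans; rewrite addnC leq_add2r; exact: H1.
case: t @M leN ltN step => [|t]; first by rewrite turanS !turan0 => M _; rewrite ltn0.
(* The full box has last vertex [t], whose colour has [q] levels; [u] vertices of the other colours
   remain, and each level carries [turan m.+1 u] sets. *)
set T := turan m.+2 t.+1; set q := (t %/ m.+2).+1; set u := t.+1 - q.
move=> M leN _ step.
have count_q : level_count m.+1 (t %% m.+2) t.+1 = q.
  by rewrite level_countS ?eqxx -1?ltnS ?ltn_pmod // /level_count ltnn addn0 addn1.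
have eT : T = q * turan m.+1 u.
  by rewrite /T (@turan_level_count m.+1 (t %% m.+2)) ?count_q // -ltnS ltn_pmod.
have eu : u = t - t %/ m.+2 by rewrite /u /q subSS.
have eM : M = maxn (turan m.+1 u) (N - T) by rewrite /M /last_link turanS addKn eu.
have leuM : turan m.+1 u <= M by rewrite eM leq_maxl.
(* More than [q] columns above [M] would have total size beyond [q * turan m.+1 u + (N - T) = N]. *)
have size_le n1 s1 : n1 + \sum_(n <- s1) n = N -> M < n1 -> all (fun n => M < n) s1 ->
    size s1 < q.
  move=> eN ltM ltMs; rewrite ltnNge; apply/negP => leq.
  have := @sum_ge_size (n1 :: s1) M.+1; rewrite /= ltM ltMs big_cons eN => /(_ isT).
  have : q.+1 * M.+1 <= (size s1).+1 * M.+1 by rewrite leq_mul2r ltnS leq.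
  have : q * turan m.+1 u <= q * M by rewrite leq_mul2l leuM orbT.
  have : N - T <= M by rewrite eM leq_maxr.
  rewrite mulSn mulnS -eT; lia.
(* Zero columns are discarded first: splitting one off would not decrease the total, on which the
   induction runs. *)
have filt : columns_bound m.+1 n0 (filter (fun n => 0 < n) s) -> columns_bound m.+1 n0 s.
  have bigf (h : nat -> nat) : h 0 = 0 ->
      \sum_(n <- filter (fun n => 0 < n) s) h n = \sum_(n <- s) h n.
    move=> h0; rewrite big_filter [RHS](bigID (fun n => 0 < n)) /= [X in _ + X]big1 ?addn0 //.
    by move=> n; rewrite -eqn0Ngt => /eqP ->.
  by rewrite /columns_bound (bigf (interior m.+1)) ?interiorx0 // (bigf id).
(* Recutting thus yields at least [q.-1] columns besides the largest; [size_le] gives the converse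
   bound. *)
have uq : (q.-1 <= u %/ m.+1)%N.
  rewrite /= leq_divRL // eu; have := leq_trunc_div t m.+2; rewrite mulnS; lia.
have final n1 s1 : n1 + \sum_(n <- s1) n = N -> all (fun n => 0 < n <= n1) s1 ->
  (M < n1 -> all (fun n => M < n) s1 -> 0 < size s1 -> size s1 < q -> columns_bound m.+1 n1 s1) ->
  columns_bound m.+1 n1 s1.
  move=> eN /allP les1 H.
  have [hs|/hasPn nhs] := boolP (has (fun n => 0 < n <= M) s1).
    by apply: step => //; apply/allP => n /les1 /andP[].
  have ltM : all (fun n => M < n) s1.
    by apply/allP => n ns; have /andP[n0' _] := les1 n ns; have := nhs n ns; rewrite n0' -ltnNge.
  case: s1 eN les1 H ltM {nhs} => [|n s1] eN les1 H ltM; first by rewrite /columns_bound big_nil.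
  have ltM1 : M < n1.
    by have /andP[_] := les1 n (mem_head _ _); apply: leq_trans; case/andP: ltM.
  exact: H ltM1 ltM isT (size_le _ _ eN ltM1 ltM).
apply: filt; have eN1 : n0 + \sum_(n <- filter (fun n => 0 < n) s) n = N.
  congr (_ + _); rewrite big_filter [RHS](bigID (fun n => 0 < n)) /= [X in _ + X]big1 ?addn0 //.
  by move=> n; rewrite -eqn0Ngt => /eqP ->.
have le1 : all (fun n => 0 < n <= n0) (filter (fun n => 0 < n) s).
  by apply/allP => n; rewrite mem_filter => /andP[-> /(allP les)].
apply: (final) => // ltM0 ltMs _ _.
have le1' : all (fun n => n <= n0) (filter (fun n => 0 < n) s).
  by apply: sub_all le1 => n /andP[].
have [p0 [p [lep sump Cp szp _]]] := recut IHm (leq_ltn_trans leuM ltM0) le1'.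
apply: Cp; rewrite eN1 in sump; apply: (final) => // ltMp0 ltMp p_gt0 szpq.
have szp1 : (size p).+1 = q by move: szp uq szpq; rewrite /=; lia.
have lep' : all (fun n => n <= p0) p by apply: sub_all lep => n /andP[].
have [r0 [r [ler sumr Cr szr lastr]]] := recut IHm (leq_ltn_trans leuM ltMp0) lep'.
apply: Cr; rewrite sump in sumr; apply: (final) => // ltMr0 ltMr r_gt0 szrq.
have geu : all (fun n => turan m.+1 u <= n) p.
  by apply: sub_all ltMp => n /ltnW; exact: leq_trans.
(* Having exactly [q] columns matters here: subtracting [turan m.+1 u] from each leaves [N - T],
   which is at most [M]. *)
move: (lastr geu); rewrite sum_subn; last by rewrite /= geu (leq_trans leuM) // ltnW.
rewrite big_cons sump /= szp1 -eT => le.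
have : M < last r0 r.
  by apply: (allP ltMr); case: (r) r_gt0 => // a r' _; rewrite /= mem_last.
by rewrite ltnNge (leq_trans le) // eM leq_maxr.
Qed.

(** * Ranks of boundary matrices *)

Section Boundary.
Variables (F : fieldType) (K : choiceType) (D : {fset {fset K}}).
Hypothesis closedD : forall A B, A \in D -> (B `<=` A)%fset -> B \in D.
Implicit Types (A B : {fset K}) (X : {fset {fset K}}) (v w : K).
Local Open Scope fset_scope.
Local Open Scope ring_scope.

Local Notation inc := (incidence F D).
Local Notation sgn := (face_sign F D).
Local Notation face j := (nth fset0 D j).

Lemma face_sign_sq A v : sgn A v * sgn A v = 1.
Proof. by rewrite -expr2 sqrr_sign. Qed.

Lemma fsetD1_inj A v w : v \in A -> A `\ w = A `\ v -> w = v.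
Proof.
move=> vA /fsetP /(_ v); rewrite !inE eqxx vA andbT /=.
by move/negbFE/eqP.
Qed.

Lemma fsetD1C A v w : A `\ v `\ w = A `\ w `\ v.
Proof. by rewrite !fsetDDl fsetUC. Qed.

Lemma incidenceD1 A v : v \in A -> inc A (A `\ v) = sgn A v.
Proof.
move=> vA; rewrite /incidence big_mkcond (big_fsetD1 v vA) /= eqxx.
rewrite big1_seq ?addr0 // => w /andP[_]; rewrite !inE => /andP[nwv _].
by case: eqP => // /(fsetD1_inj vA) e; rewrite e eqxx in nwv.
Qed.

Lemma incidence0 A B : (forall v, v \in A -> A `\ v != B) -> inc A B = 0.
Proof.
move=> H; rewrite /incidence big1_seq // => v /andP[e vA].
by have := H v vA; rewrite e.
Qed.

Lemma incidence_notin A B w : w \in B -> w \notin A -> inc A B = 0.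
Proof.
move=> wB wA; apply: incidence0 => v _; apply: contraNneq wA => e.
by move: wB; rewrite -e !inE => /andP[].
Qed.

Lemma incidence_in A B w : w \in A -> w \notin B ->
  inc A B = if B == A `\ w then sgn A w else 0.
Proof.
move=> wA wB; case: eqP => [->|ne]; first exact: incidenceD1.
apply: incidence0 => v vA; apply/eqP => e; apply: ne; rewrite -e.
by move: wB; rewrite -e !inE wA andbT negbK => /eqP ->.
Qed.

(** Coordinates are all faces of [D], of every dimension, so that a family, its deletions and its
    links have boundaries in one space with the same signs. *)
Definition bd A : 'rV[F]_(#|` D|) := \row_j inc A (face j).

Definition bdm X : 'M[F]_(#|` X|, #|` D|) := \matrix_(i < #|` X|) bd (nth fset0 X i).

Definition rk X := \rank (bdm X).

Lemma face_in (j : 'I_(#|` D|)) : face j \in D.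
Proof. exact: mem_nth. Qed.

Lemma faceP A : A \in D -> exists j : 'I_(#|` D|), face j = A.
Proof.
move=> AD; have lt : (index A D < #|` D|)%N by rewrite index_mem.
by exists (Ordinal lt); rewrite /= nth_index.
Qed.

Lemma face_inj (i j : 'I_(#|` D|)) : (face i == face j) = (i == j).
Proof. by rewrite (nth_uniq _ _ _ (fset_uniq D)). Qed.

Lemma bd_sub A X : A \in X -> (bd A <= bdm X)%MS.
Proof.
move=> AX; have lt : (index A X < #|` X|)%N by rewrite index_mem.
have -> : bd A = row (Ordinal lt) (bdm X) by rewrite rowK /= nth_index.
exact: row_sub.
Qed.

Lemma bdm_sub X n (M : 'M[F]_(n, #|` D|)) :
  (forall A, A \in X -> (bd A <= M)%MS) -> (bdm X <= M)%MS.
Proof. by move=> H; apply/row_subP => i; rewrite rowK; apply: H; exact: mem_nth. Qed.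

Lemma bdm_span X (u : 'rV_(#|` D|)) : (u <= bdm X)%MS ->
  exists a : {fset K} -> F, u = \sum_(A <- X) a A *: bd A.
Proof.
move=> /submxP[c ->].
exists (fun A => if insub (index A X) is Some i then c 0 i else 0).
rewrite (big_nth fset0) big_mkord mulmx_sum_row; apply: eq_bigr => i _.
rewrite rowK index_uniq //; last exact: fset_uniq.
by rewrite valK.
Qed.

Lemma rk_le_card X : (rk X <= #|` X|)%N.
Proof. exact: rank_leq_row. Qed.

Lemma rk_fset0 : rk fset0 = 0%N.
Proof. by apply/eqP; rewrite -leqn0 -(cardfs0 {fset K}) rk_le_card. Qed.

(* Sends a chain to (up to signs) its link at w; bijective on the coordinates
   indexed by the faces containing w. *)
Definition link_mx w : 'M[F]_(#|` D|) :=
  \matrix_(i, j) if (w \notin face j) && (face i == w |` face j) then sgn (face i) w else 0.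

Lemma link_mxE w (u : 'rV_(#|` D|)) (i j : 'I_(#|` D|)) : face i = w |` face j -> w \notin face j ->
  (u *m link_mx w) 0 j = u 0 i * sgn (face i) w.
Proof.
move=> e wj; rewrite mxE (bigD1 i) //= !mxE wj e eqxx big1 ?addr0 // => k nki.
by rewrite mxE wj -e face_inj (negbTE nki) mulr0.
Qed.

Lemma link_mx0 w (u : 'rV_(#|` D|)) (i : 'I_(#|` D|)) : u *m link_mx w = 0 -> w \in face i -> u 0 i = 0.
Proof.
move=> u0 wi.
have [j ej] := faceP (closedD (face_in i) (fsubD1set _ w)).
have ei : face i = w |` face j by rewrite ej fsetD1K.
have wj : w \notin face j by rewrite ej !inE eqxx.
have := link_mxE u ei wj; rewrite u0 mxE => /esym/eqP.
by rewrite mulf_eq0 signr_eq0 orbF => /eqP.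
Qed.

(** Taking links anticommutes with the boundary; the facet [A] minus [w] is killed since it misses
    [w]. *)
Lemma link_bd w A : A \in D ->
  bd A *m link_mx w = if w \in A then - sgn A w *: bd (A `\ w) else 0.
Proof.
move=> AD; apply/rowP => j.
have -> : (bd A *m link_mx w) 0 j =
    if w \in face j then 0 else inc A (w |` face j) * sgn (w |` face j) w.
  case: ifPn => wj.
    by rewrite mxE big1 // => i _; rewrite [link_mx _ _ _]mxE wj mulr0.
  have [/faceP[i ei]|nD] := boolP (w |` face j \in D).
    by rewrite (link_mxE _ ei wj) mxE ei.
  rewrite incidence0 ?mul0r; last first.
    by move=> v vA; apply: contraNneq nD => <-; apply: closedD AD (fsubD1set _ _).
  rewrite mxE big1 // => i _; rewrite [link_mx _ _ _]mxE wj.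
  by case: eqP => [e|_]; rewrite ?mulr0 // -e face_in in nD *.
case: (boolP (w \in A)) => wA; last first.
  rewrite mxE; case: ifP => // _; rewrite (@incidence_notin _ _ w) ?mul0r //.
  by rewrite !inE eqxx.
rewrite !mxE; case: ifPn => wj.
  by rewrite (incidence_notin wj) ?mulr0 // !inE eqxx.
have [/hasP[v vA /eqP e]|/hasPn nh] := boolP (has (fun v => A `\ w `\ v == face j) (A `\ w)).
  have /andP[nvw vA'] : (v != w) && (v \in A) by move: vA; rewrite !inE.
  have -> : w |` face j = A `\ v.
    by rewrite -e fsetD1C fsetD1K // !inE eq_sym nvw.
  by rewrite -e !incidenceD1 // mulNr -face_signD1 // eq_sym.
rewrite [inc (A `\ w) _]incidence0; last by move=> v /nh.
rewrite mulr0 incidence0 ?mul0r // => v vA; apply/eqP => e.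
have wv : w \in A `\ v by rewrite e !inE eqxx.
have vw : v \in A `\ w by move: wv; rewrite !inE vA eq_sym => /andP[->].
have := nh v vw; rewrite fsetD1C e.
by rewrite fsetU1K // eqxx.
Qed.

Definition del w X := [fset A in X | w \notin A].
Definition lnk w X := [fset A `\ w | A in [fset A in X | w \in A]].

Lemma lnkP w X B : reflect (w \notin B /\ w |` B \in X) (B \in lnk w X).
Proof.
apply: (iffP idP) => [/imfsetP[/= A]|[wB BX]].
  by rewrite !inE => /andP[AX wA] ->; rewrite fsetD1K // !inE eqxx.
by apply/imfsetP; exists (w |` B); rewrite /= ?fsetU1K // !inE eqxx BX.
Qed.

Lemma card_del_lnk w X : #|` X| = (#|` del w X| + #|` lnk w X|)%N.
Proof.
have -> : #|` lnk w X| = #|` [fset A in X | w \in A]|.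
  rewrite /lnk card_in_imfset // => A B.
  by rewrite !inE => /andP[_ wA] /andP[_ wB] e; rewrite -(fsetD1K wA) e fsetD1K.
rewrite -cardfsUI.
have -> : del w X `&` [fset A in X | w \in A] = fset0.
  by apply/fsetP => A; rewrite !inE; case: (A \in X); case: (w \in A).
rewrite cardfs0 addn0; congr #|` _|; apply/fsetP => A; rewrite !inE.
by case: (A \in X); case: (w \in A).
Qed.

(** Rank-nullity for [link_mx w] on the span of the boundaries: its image contains the boundaries of
    the link, its kernel those of the deletion. *)
Lemma rk_ge_del_lnk w X : X `<=` D -> (rk (del w X) + rk (lnk w X) <= rk X)%N.
Proof.
move=> /fsubsetP XD; rewrite {3}/rk -(mxrank_mul_ker (bdm X) (link_mx w)) addnC.
apply: leq_add; apply: mxrankS; apply: bdm_sub => A.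
  move=> /lnkP[wA AX]; have := link_bd w (XD _ AX).
  rewrite !inE eqxx /= fsetU1K // => e.
  have -> : bd A = - sgn (w |` A) w *: (bd (w |` A) *m link_mx w).
    by rewrite e scalerA mulrNN face_sign_sq scale1r.
  by rewrite scalemx_sub // submxMr // bd_sub.
rewrite !inE => /andP[AX wA]; rewrite sub_capmx bd_sub //=.
by apply/sub_kermxP; rewrite link_bd ?XD // (negbTE wA).
Qed.

(** For a combination killed by [link_mx w], the sets containing [w] form a cone from [w] over a
    cycle z. Its boundary is z up to sign, and so is that of the cone from [v] over z, whose members
    lie in the deletion. *)
Lemma rk_le_del_lnk v w X : X `<=` D -> v != w ->
  (forall A, A \in X -> w \in A -> v \notin A /\ v |` (A `\ w) \in X) ->
  (rk X <= rk (del w X) + rk (lnk w X))%N.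
Proof.
move=> /fsubsetP XD nvw cone.
rewrite {1}/rk -(mxrank_mul_ker (bdm X) (link_mx w)) addnC.
apply: leq_add; apply: mxrankS; last first.
  apply/row_subP => i; rewrite row_mul rowK link_bd; last by apply: XD; exact: mem_nth.
  case: ifP => wA; last exact: sub0mx.
  by rewrite scalemx_sub // bd_sub //; apply/lnkP; rewrite fsetD1K // !inE eqxx mem_nth.
apply/row_subP => i; set u := row i _.
have : (u <= bdm X :&: kermx (link_mx w))%MS by exact: row_sub.
rewrite sub_capmx => /andP[/bdm_span[a ->] /sub_kermxP]; rewrite mulmx_suml {u} => u0.
have vw0 A : A \in X -> w \in A -> v \notin A `\ w.
  by move=> AX /(cone A AX)[vA _]; rewrite !inE negb_and vA orbT.
have coneD A : A \in X -> w \in A -> v |` (A `\ w) \in del w X.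
  by move=> AX wA; have [_] := cone A AX wA; rewrite !inE eqxx orbF eq_sym nvw => ->.
set u1 := \sum_(A <- X | w \in A) a A *: bd A.
set u2 := \sum_(A <- X | w \in A)
  (a A * sgn A w * sgn (v |` (A `\ w)) v) *: bd (v |` (A `\ w)).
have link1 : u1 *m link_mx w = - \sum_(A <- X | w \in A) (a A * sgn A w) *: bd (A `\ w).
  rewrite mulmx_suml -sumrN big_seq_cond [RHS]big_seq_cond; apply: eq_bigr => A /andP[AX wA].
  by rewrite -scalemxAl link_bd ?XD // wA scalerA mulrN scaleNr.
have link1_0 : u1 *m link_mx w = 0.
  rewrite -[RHS]u0 mulmx_suml big_mkcond big_seq [RHS]big_seq; apply: eq_bigr => A AX.
  by rewrite -scalemxAl link_bd ?XD //; case: (w \in A); rewrite ?scaler0.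
have link2_0 : u2 *m link_mx v = 0.
  rewrite -[RHS]link1_0 link1 mulmx_suml -sumrN big_seq_cond [RHS]big_seq_cond.
  apply: eq_bigr => A /andP[AX wA].
  have [_ AD] := cone A AX wA.
  rewrite -scalemxAl link_bd ?XD // !inE eqxx /= fsetU1K ?vw0 //.
  by rewrite scalerA mulrN -(mulrA _ (sgn _ v)) face_sign_sq mulr1 scaleNr.
have u12 : u1 = u2.
  apply/rowP => j; case: (boolP (w \in face j)) => wj.
    rewrite (link_mx0 link1_0 wj) summxE big_seq_cond big1 // => A /andP[AX wA].
    by rewrite !mxE (incidence_notin wj) ?mulr0 // !inE eqxx orbF eq_sym.
  case: (boolP (v \in face j)) => vj.
    rewrite (link_mx0 link2_0 vj) summxE big_seq_cond big1 // => A /andP[AX wA].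
    have [vA _] := cone A AX wA.
    by rewrite !mxE (incidence_notin vj) ?mulr0.
  rewrite !summxE big_seq_cond [RHS]big_seq_cond; apply: eq_bigr => A /andP[AX wA].
  rewrite !mxE (incidence_in wA wj) (@incidence_in _ _ v) ?inE ?eqxx //.
  rewrite fsetU1K ?vw0 //; case: ifP => _; last by rewrite !mulr0.
  by rewrite -[RHS]mulrA face_sign_sq mulr1.
rewrite (bigID (fun A => w \in A)) /= -/u1 u12 addmx_sub //.
  rewrite /u2 big_seq_cond summx_sub // => A /andP[AX wA].
  by rewrite scalemx_sub // bd_sub // coneD.
rewrite big_seq_cond summx_sub // => A /andP[AX wA].
by rewrite scalemx_sub // bd_sub // !inE AX.
Qed.

Lemma rk_cone v X : X `<=` D -> (forall A, A \in X -> v \in A) -> rk X = #|` X|.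
Proof.
move=> /fsubsetP XD vX; apply/eqP; apply/row_freeP.
(* A right inverse: it reads the coordinate at the only facet of each set that misses [v]. *)
exists (\matrix_(j, i) if face j == nth fset0 X i `\ v then sgn (nth fset0 X i) v else 0).
apply/matrixP => i k; rewrite !mxE.
set A := nth fset0 X k; set B := nth fset0 X i.
have AX : A \in X by exact: mem_nth.
have BX : B \in X by exact: mem_nth.
have [j ej] := faceP (closedD (XD _ AX) (fsubD1set _ v)).
rewrite (bigD1 j) //= big1 ?addr0; last first.
  by move=> l nlj; rewrite !mxE -/A -ej face_inj (negbTE nlj) mulr0.
have vA : v \notin A `\ v by rewrite !inE eqxx.
rewrite !mxE -/A -/B ej eqxx (incidence_in (vX _ BX) vA).
case: eqP => [e|ne].
  have eAB : A = B by rewrite -(fsetD1K (vX _ AX)) e fsetD1K // vX.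
  have -> : i = k by apply/eqP; rewrite -val_eqE /= -(nth_uniq fset0 (ltn_ord i) (ltn_ord k) (fset_uniq X)); apply/eqP.
  by rewrite eqxx eAB face_sign_sq.
rewrite mul0r; case: eqP => // eik; case: ne.
by rewrite /A /B eik.
Qed.

End Boundary.

Lemma rank_boundary_mx (F : fieldType) (K : choiceType) (D : {fset {fset K}}) k :
  \rank (boundary_mx F D k) = rk F D (faces D k.+1).
Proof.
have facesD (j : 'I_(#|` faces D k|)) : nth fset0 (faces D k) j \in D.
  have : nth fset0 (faces D k) j \in faces D k by exact: mem_nth.
  by rewrite !inE => /andP[].
(* [S] selects the faces of cardinality [k]; all other coordinates of these boundaries vanish. *)
pose S : 'M[F]_(#|` D|, #|` faces D k|) :=
  (\matrix_(i, j) (nth fset0 D i == nth fset0 (faces D k) j)%:R)%R.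
apply/eqP; rewrite eqn_leq; apply/andP; split.
  have -> : boundary_mx F D k = (bdm F D (faces D k.+1) *m S)%R.
    apply/matrixP => i j; rewrite !mxE.
    have [l el] := faceP (facesD j).
    rewrite (bigD1 l) //= !mxE el eqxx mulr1 big1 ?addr0 // => h nhl.
    by rewrite !mxE -el face_inj (negbTE nhl) mulr0.
  exact: mxrankM_maxl.
rewrite /rk; suff -> : bdm F D (faces D k.+1) = (boundary_mx F D k *m S^T)%R by exact: mxrankM_maxl.
apply/matrixP => i j; rewrite !mxE.
set A := nth _ (faces D k.+1) i; set B := nth _ D j.
have /andP[AD /eqP cA] : (A \in D) && (#|` A| == k.+1).
  have : A \in faces D k.+1 by exact: mem_nth.
  by rewrite !inE.
have [BF|nBF] := boolP (B \in faces D k).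
  have [l el] := faceP BF.
  rewrite (bigD1 l) //= !mxE el eqxx mulr1 big1 ?addr0 // => h nhl.
  by rewrite !mxE -/B -el face_inj eq_sym (negbTE nhl) mulr0.
rewrite big1 => [|h _]; last first.
  rewrite !mxE; case: eqP => [e|_]; last by rewrite mulr0.
  by move: nBF; rewrite /B e mem_nth.
apply: incidence0 => v vA; apply: contraNneq nBF => e.
have BD : B \in D by exact: mem_nth.
rewrite !inE /= BD -e /=; move: cA; rewrite (cardfsD1 v) vA add1n => -[->].
exact: eqxx.
Qed.

Lemma betti_top (F : fieldType) (K : choiceType) (D : {fset {fset K}}) k :
  faces D k.+2 = fset0 -> betti F D k = (#|` faces D k.+1| - rk F D (faces D k.+1))%N.
Proof.
move=> F0; rewrite /betti mxrank_ker rank_boundary_mx.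
suff -> : \rank (boundary_mx F D k.+1) = 0%N by rewrite subn0.
by rewrite rank_boundary_mx F0 rk_fset0.
Qed.

(** * Upper bound for the rank of a shifted family *)

Section Shifted.
Variables (F : fieldType) (K : choiceType) (D : {fset {fset K}}).
Hypothesis closedD : forall A B, A \in D -> (B `<=` A)%fset -> B \in D.
Implicit Types (A B V : {fset K}) (X : {fset {fset K}}) (v w : K).
Local Open Scope fset_scope.

Variable base : K -> K.
Hypothesis base_base : forall w, base (base w) = base w.

Definition has_base A := has (fun w => base w == w) A.

Definition base_shifted X := forall A w, A \in X -> w \in A -> base w != w ->
  base w \notin A /\ base w |` (A `\ w) \in X.

Lemma base_shifted_del w X : base w != w -> base_shifted X -> base_shifted (del w X).
Proof.
move=> nw sX A u; rewrite !inE => /andP[AX wA] uA nu.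
have [bA bX] := sX A u AX uA nu; split; rewrite // bX /= negb_or negb_and wA orbT andbT.
by apply: contra_neq nw => ->; rewrite base_base.
Qed.

Lemma base_shifted_lnk w X : base w != w -> base_shifted X -> base_shifted (lnk w X).
Proof.
move=> nw sX A u /lnkP[wA AX] uA nu.
have [|bA bX] := sX _ u AX _ nu; first by rewrite !inE uA orbT.
have nuw : u != w by apply: contraNneq wA => <-.
split; first by apply: contraNN bA => ?; rewrite !inE orbC; apply/orP; left.
apply/lnkP; split.
  rewrite !inE negb_or negb_and wA orbT andbT.
  by apply: contra_neq nw => ->; rewrite base_base.
suff -> : w |` (base u |` A `\ u) = base u |` ((w |` A) `\ u) by [].
apply/fsetP => x; rewrite !inE; case: (x =P w) => [->|]; rewrite ?orbT //=.
by rewrite (eq_sym w u) nuw orbT.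
Qed.

(** Each vertex [w] not fixed by [base] is split off by [rk_le_del_lnk] with apex [base w]. In the
    end only base vertices are left, and every non-empty set counts. *)
Lemma rk_base_shifted X : X `<=` D -> base_shifted X ->
  rk F D X <= #|` [fset A in X | has_base A]|.
Proof.
have [V HV] : exists V, forall A w, A \in X -> w \in A -> base w != w -> w \in V.
  by exists (\bigcup_(A <- X) A) => A w AX wA _; apply/bigfcupP; exists A; rewrite ?AX.
have [n] := ubnP #|` V|; elim: n V X HV => // n IH V X HV ltn XD sX.
have [V0|[w wV]] := fset_0Vmem V.
  apply: leq_trans (rk_le_card F D _); apply: mxrankS; apply: bdm_sub => A AX.
  have [A0|[w wA]] := fset_0Vmem A.
    rewrite (_ : bd _ _ _ = 0%R) ?sub0mx //; apply/rowP => j; rewrite !mxE.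
    by apply: incidence0 => v; rewrite A0 inE.
  apply: bd_sub; rewrite !inE AX /=; apply/hasP; exists w => //.
  by apply/negPn/negP => /(HV A w AX wA); rewrite V0 inE.
have ltV : #|` V `\ w| < n by move: ltn; rewrite (cardfsD1 w V) wV add1n ltnS.
have [bw|nw] := eqVneq (base w) w.
  apply: (IH (V `\ w)) => // A u AX uA nu; rewrite !inE (HV A u) // andbT.
  by apply: contra_neq nu => ->.
apply: leq_trans (rk_le_del_lnk F closedD XD nw _) _.
  by move=> A AX wA; exact: sX.
rewrite (card_del_lnk w); apply: leq_add.
  apply: leq_trans (IH (V `\ w) _ _ _ _ _) _ => //.
  - move=> A u; rewrite !inE => /andP[AX wA] uA nu; rewrite (HV A u) // andbT.
    by apply: contraNneq wA => <-.
  - by apply: fsubset_trans XD; apply/fsubsetP => A; rewrite !inE => /andP[].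
  - exact: base_shifted_del.
  - apply: fsubset_leq_card; apply/fsubsetP => A; rewrite !inE => /andP[/andP[-> ->] ->].
    by [].
apply: leq_trans (IH (V `\ w) _ _ _ _ _) _ => //.
- move=> A u /lnkP[wA AX] uA nu; rewrite !inE (HV _ u AX) ?inE ?uA ?orbT // andbT.
  by apply: contraNneq wA => <-.
- apply/fsubsetP => A /lnkP[_ /(fsubsetP XD) AD].
  by apply: closedD AD _; exact: fsubsetU1.
- exact: base_shifted_lnk.
apply: fsubset_leq_card; apply/fsubsetP => A; rewrite !inE => /andP[/lnkP[wA AX] hA].
apply/lnkP; split; rewrite // !inE AX /=; have /hasP[u uA bu] := hA.
by apply/hasP; exists u; rewrite // !inE uA orbT.
Qed.

End Shifted.

(** * Upper bound for the top Betti number of a flag complex *)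

Section Cliques.
Variables (F : fieldType) (K : choiceType) (D : {fset {fset K}}).
Hypothesis flagD : flag_complex D.
Implicit Types (A B W : {fset K}) (v w u : K).
Local Open Scope fset_scope.

Let closedD : forall A B, A \in D -> B `<=` A -> B \in D.
Proof. by case: flagD => -[]. Qed.

Definition neighbours w := [fset u in vertices D | (u != w) && ([fset u; w] \in D)].

Definition cliques W n := [fset A in D | (#|` A| == n) && (A `<=` W)].

Lemma cliques_sub W n : cliques W n `<=` D.
Proof. by apply/fsubsetP => A; rewrite !inE => /andP[]. Qed.

Lemma cliques_mono W W' n : W `<=` W' -> cliques W n `<=` cliques W' n.
Proof.
move=> WW'; apply/fsubsetP => A; rewrite !inE => /and3P[-> -> /fsubset_trans ->] //.
Qed.

Lemma del_cliques w W n : del w (cliques W n) = cliques (W `\ w) n.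
Proof. by apply/fsetP => A; rewrite !inE fsubsetD1 -!andbA. Qed.

Lemma mem_vertices A v : A \in D -> v \in A -> v \in vertices D.
Proof. by move=> AD vA; apply/bigfcupP; exists A; rewrite ?AD. Qed.

(** Flagness makes the link an induced subcomplex of the same [D], so the induction can run over
    vertex sets [W]. *)
Lemma lnk_cliques w W n : w \in W -> w \in vertices D ->
  lnk w (cliques W n.+1) = cliques (W `&` neighbours w) n.
Proof.
move=> wW /bigfcupP[A0 /andP[A0D _] wA0].
have wD : [fset w; w] \in D.
  by apply: closedD A0D _; apply/fsubsetP => x; rewrite !inE orbb => /eqP ->.
apply/fsetP => A; apply/lnkP/idP => [[wA]|].
  rewrite !inE cardfsU1 wA add1n eqSS => /and3P[wAD -> wAW].
  rewrite (closedD wAD) ?fsubsetU1 //= fsubsetI (fsubset_trans (fsubsetU1 w A)) //=.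
  apply/fsubsetP => u uA; rewrite !inE (mem_vertices wAD) ?inE ?uA ?orbT //=.
  rewrite (contraNneq _ wA) => [|<- //]; apply: closedD wAD _.
  by apply/fsubsetP => x; rewrite !inE => /orP[] /eqP ->; rewrite ?uA ?eqxx ?orbT.
rewrite !inE fsubsetI => /and4P[AD cA AW /fsubsetP AN].
have adj u : u \in A -> (u != w) && ([fset u; w] \in D).
  by move=> /AN; rewrite !inE => /andP[].
have wA : w \notin A by apply/negP => /adj; rewrite eqxx.
split=> //; rewrite cardfsU1 wA add1n eqSS cA /=; apply/andP; split; last first.
  by apply/fsubsetP => x; rewrite !inE => /orP[/eqP ->|/(fsubsetP AW)].
case: flagD => _; apply => u v; rewrite !inE => /orP[/eqP->|uA] /orP[/eqP->|vA] //.
- by rewrite fsetUC; have /andP[] := adj v vA.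
- by have /andP[] := adj u uA.
apply: closedD AD _; apply/fsubsetP => x.
by rewrite !inE => /orP[] /eqP ->.
Qed.

(* Vertices not adjacent to v are removed one at a time, which ends with a
   cone over the link of v; the link of v having the most facets, the facet
   numbers of the links removed on the way are columns of a shifted family. *)
Lemma cliques_bound m W : W `<=` vertices D -> cliques W m.+1 = fset0 ->
  #|` cliques W m| <= rk F D (cliques W m) + interior m #|` cliques W m|.
Proof.
elim: m W => [|m IHm] W /fsubsetP WV cW; first by rewrite interior0x leq_addl.
have [W0|nW0] := eqVneq W fset0.
  suff -> : cliques W m.+1 = fset0 by rewrite cardfs0.
  apply/fsetP => A; rewrite !inE W0 fsubset0; apply/negP => /and3P[_ cA /eqP A0].
  by rewrite A0 cardfs0 in cA.
have [|v vW maxv] := @exists_max_seq _ W (fun w => #|` cliques (W `&` neighbours w) m|).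
  by apply: contra_neq nW0 => /= W0; apply/fsetP => x; rewrite inE -[x \in W]/(x \in enum_fset W) W0.
have linkW0 w W' : w \in W -> W' `<=` W -> cliques (W' `&` neighbours w) m.+1 = fset0.
  move=> wW W'W; apply/eqP; rewrite -fsubset0.
  apply: (fsubset_trans (cliques_mono (W' := W `&` neighbours w) _ _)).
    exact: fsetSI.
  rewrite -lnk_cliques ?WV // cW; apply/fsubsetP => A /lnkP[_].
  by rewrite inE.
set n1 := #|` cliques (W `&` neighbours v) m| in maxv.
set R := v |` (W `&` neighbours v).
(* [s] lists the facet numbers of the links of the vertices to be removed from [W'] before only [R],
   the closed neighbourhood of [v] in [W], remains. *)
suff H W' : R `<=` W' -> W' `<=` W -> exists s,
  [/\ all (fun n => n <= n1) s, (#|` cliques W' m.+1| = n1 + \sum_(n <- s) n)%N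
    & (#|` cliques W' m.+1| <= rk F D (cliques W' m.+1) + \sum_(n <- s) interior m n)%N].
  have [|s [les card le]] := H W _ (fsubset_refl W).
    by apply/fsubsetP => x; rewrite !inE => /orP[/eqP->|/andP[]].
  by apply: leq_trans le _; rewrite leq_add2l card; exact: interior_columns.
have [n] := ubnP #|` W'|; elim: n W' => // n IHn W' ltn RW' W'W.
have [W'R|/fsubsetPn[w wW' wR]] := boolP (W' `<=` R).
  have {ltn RW' W'W W'R} -> : W' = R by apply/eqP; rewrite eqEfsubset W'R.
  have vR : v \in R by rewrite !inE eqxx.
  have RN : R `&` neighbours v = W `&` neighbours v.
    apply/fsetP => x; rewrite !inE.
    by case: (x =P v) => [->|]; rewrite ?andbF //= -andbA andbb.
  (* A facet avoiding [v] would be a clique of size [m.+1] among the neighbours of [v], excluded by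
     [linkW0]. *)
  have cone A : A \in cliques R m.+1 -> v \in A.
    apply: contraTT => vA; apply/negP => AR.
    have : A \in del v (cliques R m.+1) by move: AR; rewrite !inE => ->.
    have RvN : R `\ v `<=` W `&` neighbours v.
      by apply/fsubsetP => x; rewrite !inE => /andP[/negbTE ->].
    rewrite del_cliques => /(fsubsetP (cliques_mono _ RvN)).
    by rewrite linkW0 ?fsubset_refl // inE.
  exists [::]; split=> //; last by rewrite (rk_cone F closedD (cliques_sub _ _) cone) leq_addr.
  rewrite big_nil addn0 (card_del_lnk v) lnk_cliques ?WV // RN.
  suff -> : del v (cliques R m.+1) = fset0 by rewrite cardfs0.
  by apply/fsetP => A; rewrite [in RHS]inE; apply/negP; rewrite inE /= => /andP[/cone ->].
have wW : w \in W by exact: (fsubsetP W'W).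
have nvw : v != w by apply: contraNneq wR => <-; rewrite !inE eqxx.
have [|||s [les card le]] := IHn (W' `\ w).
- by move: ltn; rewrite (cardfsD1 w W') wW' add1n ltnS.
- by rewrite fsubsetD1 RW' wR.
- exact: fsubset_trans (fsubsetDl _ _) W'W.
set c := #|` cliques (W' `&` neighbours w) m|.
have lec : c <= n1.
  by apply: leq_trans (maxv w wW); apply/fsubset_leq_card/cliques_mono/fsetSI.
exists (c :: s); split; first by rewrite /= lec.
  by rewrite (card_del_lnk w) del_cliques lnk_cliques ?WV // card big_cons -/c; lia.
have := rk_ge_del_lnk F closedD w (cliques_sub W' m.+1).
rewrite (card_del_lnk w) del_cliques lnk_cliques ?WV // big_cons.
have := IHm (W' `&` neighbours w) _ (linkW0 w W' wW W'W); rewrite -/c.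
have -> : W' `&` neighbours w `<=` vertices D.
  by apply/fsubsetP => x; rewrite inE => /andP[/(fsubsetP W'W)/WV].
move=> /(_ isT); lia.
Qed.

Lemma vertices_cliques n : cliques (vertices D) n = faces D n.
Proof.
apply/fsetP => A; rewrite !inE /=; case: (boolP (A \in D)) => //= AD.
suff -> : A `<=` vertices D by rewrite andbT.
by apply/fsubsetP => v; exact: mem_vertices.
Qed.

Lemma betti_flag_le d : faces D d.+2 = fset0 ->
  betti F D d <= interior d.+1 (fnum D d).
Proof.
move=> F0; rewrite betti_top // /fnum.
have := @cliques_bound d.+1 (vertices D) (fsubset_refl _).
rewrite !vertices_cliques => /(_ F0); lia.
Qed.

End Cliques.

(** * The revlex complex *)

Lemma vertex_eq m a b i j : i < m -> j < m -> a * m + i = b * m + j -> a = b /\ i = j.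
Proof.
move=> lti ltj e; have m0 : 0 < m by exact: leq_ltn_trans lti.
have eij : i = j by rewrite -(modn_small lti) -(modnMDl a) e modnMDl modn_small.
by split=> //; move: e; rewrite eij => /addIn/eqP; rewrite eqn_pmul2r // => /eqP.
Qed.

Lemma vertex_lt m a b i j : i < m -> j < m ->
  (a * m + i < b * m + j) = (a < b) || (a == b) && (i < j).
Proof.
move=> lti ltj; case: (ltngtP a b) => [lt|gt|->] /=; last by rewrite ltn_add2l.
  by move: lt; rewrite -(leq_pmul2r (leq_ltn_trans (leq0n _) lti)) mulSn; lia.
apply/negbTE; rewrite -leqNgt.
by move: gt; rewrite -(leq_pmul2r (leq_ltn_trans (leq0n _) lti)) mulSn; lia.
Qed.

Lemma tup_surj m f u : (forall c, c < m -> f c * m + c < u) ->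
  exists2 k, k < turan m u & forall c, c < m -> tup m k c = f c.
Proof.
elim: m f u => [|m IHm] f u bnd; first by exists 0.
have [|c0 _ maxc] := @exists_max_seq _ (enum 'I_m.+1) (fun c => f c * m.+1 + c).
  by rewrite -size_eq0 size_enum_ord.
set c := val c0 in maxc; have ltc : c < m.+1 by exact: ltn_ord.
have {}maxc i : i < m.+1 -> f i * m.+1 + i <= f c * m.+1 + c.
  by move=> lti; have := maxc (Ordinal lti); rewrite mem_enum => /(_ isT).
set t := f c * m.+1 + c in maxc.
have et : t %% m.+1 = c by rewrite modnMDl modn_small.
have lt : t %/ m.+1 = f c by rewrite divnMDl // divn_small // addn0.
have [|y lty yE] := IHm (fun i => f (bump c i)) (t - t %/ m.+1).
  move=> i lti; have ltbi : bump c i < m.+1 by rewrite /bump; lia.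
  rewrite lt (_ : t - f c = f c * m + c); last by rewrite /t mulnS; lia.
  have hb : f (bump c i) * m.+1 + bump c i < f c * m.+1 + c.
    rewrite ltn_neqAle maxc // andbT; apply/eqP => /(vertex_eq ltbi ltc)[_ e].
    by have := neq_bump c i; rewrite e eqxx.
  move: hb; rewrite vertex_lt //; case: (ltngtP (f (bump c i)) (f c)) => [ltf _|//|-> /= ltb].
    by move: ltf; rewrite -(leq_pmul2r (leq_ltn_trans (leq0n _) lti)) mulSn; lia.
  by rewrite ltn_add2l; move: ltb; rewrite /bump; lia.
exists (turan m.+1 t + y).
  have ltu : t < u by exact: bnd.
  by apply: leq_trans (leq_turan _ ltu); rewrite turanS ltn_add2l.
move=> i lti; rewrite tupE // /insert_at et lt; case: eqP => [->//|/eqP nei].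
by rewrite yE ?unbumpK //; apply: unbump_lt.
Qed.

(** This is the revlex comparison in terms of levels: [c] is the colour of the deciding vertex. For
    [m = 0] the bound by [u] leaves no room for [k < k']. *)
Lemma tup_lt m k k' u : k < k' -> k' < turan m u ->
  exists c, [/\ c < m, tup m k c != tup m k' c
    & forall i, i < m -> tup m k i != tup m k' i -> tup m k i * m + i < tup m k' c * m + c].
Proof.
elim: m k k' u => [|m IHm] k k' u ltk; first by case: k' ltk.
move=> _; have [t [y [ek lty]]] := tup_blockP m k; have [t' [y' [ek' lty']]] := tup_blockP m k'.
have letop : t <= t'.
  rewrite leqNgt; apply/negP => /(leq_turan m.+1); rewrite turanS; lia.
have [ett|ltt] := eqVneq t t'; last first.
  have {}ltt : t < t' by rewrite ltn_neqAle ltt.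
  have ltkt i : i < m.+1 -> tup m.+1 k i * m.+1 + i < t'.
    move=> lti; apply: leq_trans ltt; apply: tup_vertex_lt => //.
    by rewrite turanS ek ltn_add2l.
  have e : tup m.+1 k' (t' %% m.+1) * m.+1 + t' %% m.+1 = t'.
    by rewrite ek' tupE // /insert_at eqxx -divn_eq.
  exists (t' %% m.+1); split; rewrite ?ltn_pmod //.
    apply/eqP => e'; have := ltkt (t' %% m.+1) (ltn_pmod _ (ltn0Sn m)).
    by rewrite e' e ltnn.
  by move=> i lti _; rewrite e ltkt.
subst t'; have ltyy : y < y' by lia.
have [c [ltc nec cP]] := IHm y y' _ ltyy lty'.
set e := t %% m.+1; have lte : e < m.+1 by exact: ltn_pmod.
have tupb x i : x < turan m (t - t %/ m.+1) ->
    tup m.+1 (turan m.+1 t + x) (bump e i) = tup m x i.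
  by move=> ltx; rewrite tupE // /insert_at eq_sym (negbTE (neq_bump _ _)) bumpK.
have bump_ltm i : i < m -> bump e i < m.+1 by rewrite /bump; lia.
rewrite ek ek'; exists (bump e c); split; rewrite ?tupb ?bump_ltm // => i lti.
have [->|nei] := eqVneq i e; first by rewrite !tupE // /insert_at eqxx eqxx.
have ltui : unbump e i < m by exact: unbump_lt.
rewrite -(unbumpK nei) !tupb // => /(cP _ ltui).
rewrite !vertex_lt ?bump_ltm // => /orP[->//|/andP[-> ltuc]]; apply/orP; right.
by move: ltuc; rewrite /bump /=; lia.
Qed.

Lemma small_color_inj m x y : 0 < x -> 0 < y -> x <= m -> y <= m ->
  x.-1 %% m = y.-1 %% m -> x = y.
Proof.
move=> x0 y0 lex ley; rewrite !modn_small ?prednK // => e.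
by rewrite -(prednK x0) e prednK.
Qed.

(** * Rainbow sets as tuples of levels *)

Section RainbowSets.
Local Open Scope fset_scope.
Implicit Types (A B : {fset nat}).

(** The integer [x] is vertex [x.-1] of the enumeration, so the class with index [i] in [1..m] is
    colour [i - 1]. *)
Lemma rainbowP m j A : 0 < m ->
  rainbow m j A <-> [/\ forall x, x \in A -> 0 < x, #|` A| = j
    & {in A &, injective (fun x => x.-1 %% m)}].
Proof.
move=> m0; have modP x y : 0 < x -> 0 < y -> (x == y %[mod m]) = (x.-1 %% m == y.-1 %% m).
  by case: x y => [//|x] [//|y] _ _ /=; rewrite -[x.+1]addn1 -[y.+1]addn1 eqn_modDr.
split=> -[pos card inj]; split=> //.
  move=> x y xA yA /eqP exy; set i := (x.-1 %% m).+1.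
  have lei : 1 <= i <= m by rewrite /i /= ltn_pmod.
  have Pi z : z \in A -> z.-1 %% m == x.-1 %% m -> z \in [fset n in A | Pi_class m i n].
    by move=> zA ez; rewrite !inE /= zA /Pi_class pos //= modP // ?pos //= /i /= modn_mod.
  have := inj i lei; rewrite leqNgt => /negP ncard; apply/eqP/negPn/negP => nexy.
  apply: ncard; rewrite -[1.+1]/(true.+1) -nexy -cardfs2; apply: fsubset_leq_card.
  by apply/fsubsetP => z; rewrite in_fset2 => /orP[] /eqP ->; rewrite Pi // eq_sym.
move=> i _; set Y := [fset n in A | _].
have [->|[x xY]] := fset_0Vmem Y; first by rewrite cardfs0.
rewrite -(cardfs1 x); apply: fsubset_leq_card; apply/fsubsetP => y yY.
move: xY yY; rewrite !inE /= => /and3P[xA x0 /eqP ex] /and3P[yA y0 /eqP ey].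
by apply/eqP; apply: inj => //; apply/eqP; rewrite -modP // ey ex.
Qed.

Lemma rainbow_sub m j A B : 0 < m -> rainbow m j A -> B `<=` A -> rainbow m #|` B| B.
Proof.
move=> m0 /(rainbowP _ _ m0)[pos _ inj] /fsubsetP BA; apply/(rainbowP _ _ m0); split=> //.
  by move=> x /BA/pos.
by move=> x y /BA xA /BA yA; exact: inj.
Qed.

Lemma rainbow_color m A c : c < m -> rainbow m m A -> exists2 x, x \in A & x.-1 %% m = c.
Proof.
move=> ltc; have m0 : 0 < m by exact: leq_ltn_trans ltc.
move=> /(rainbowP _ _ m0)[_ card inj].
have uniq_col : uniq [seq x.-1 %% m | x <- A] by rewrite map_inj_in_uniq ?fset_uniq.
have [||_ eqi] := uniq_min_size uniq_col (s2 := iota 0 m).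
- by move=> _ /mapP[x _ ->]; rewrite mem_iota /= ltn_pmod.
- by rewrite size_iota size_map card.
have : c \in [seq x.-1 %% m | x <- A] by rewrite eqi mem_iota.
by move=> /mapP[x xA ->]; exists x.
Qed.

Definition tuple_set m (f : nat -> nat) : {fset nat} :=
  [fset x | x in [seq (f c * m + c).+1 | c <- iota 0 m]].

Lemma tuple_setP m f x :
  reflect (exists2 c, c < m & x = (f c * m + c).+1) (x \in tuple_set m f).
Proof.
rewrite /tuple_set inE /=; apply: (iffP mapP) => -[c]; rewrite ?mem_iota.
  by move=> ltc ->; exists c.
by move=> ltc ->; exists c; rewrite ?mem_iota.
Qed.

Lemma mem_tuple_set m f a c : c < m -> ((a * m + c).+1 \in tuple_set m f) = (a == f c).
Proof.
move=> ltc; apply/tuple_setP/eqP => [[i lti [/(vertex_eq ltc lti)[-> ->]]]|->] //.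
by exists c.
Qed.

Lemma eq_tuple_set m f g : (forall c, c < m -> f c = g c) -> tuple_set m f = tuple_set m g.
Proof.
move=> fg; apply/fsetP => x; apply/tuple_setP/tuple_setP => -[c ltc ->]; exists c => //.
  by rewrite fg.
by rewrite fg.
Qed.

Lemma rainbow_tuple_set m f : 0 < m -> rainbow m m (tuple_set m f).
Proof.
move=> m0; apply/(rainbowP _ _ m0); split.
- by move=> x /tuple_setP[c _ ->].
- rewrite /tuple_set card_imfset //= undup_id ?size_map ?size_iota //.
  rewrite map_inj_in_uniq ?iota_uniq // => a b; rewrite !mem_iota /= => lta ltb.
  by move=> [/(vertex_eq lta ltb)[]].
move=> _ _ /tuple_setP[a lta ->] /tuple_setP[b ltb ->] /=.
by rewrite !modnMDl !modn_small // => ->.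
Qed.

Lemma rainbow_tupleP m A : 0 < m -> rainbow m m A -> exists k, A = tuple_set m (tup m k).
Proof.
move=> m0 rA; have /(rainbowP _ _ m0)[pos card _] := rA.
pose f c := (nth 0 A (find (fun x => x.-1 %% m == c) A)).-1 %/ m.
have fA c : c < m -> (f c * m + c).+1 \in A.
  move=> ltc; have [x xA ex] := rainbow_color ltc rA.
  have hx : has (fun x => x.-1 %% m == c) A by apply/hasP; exists x; rewrite // ex.
  have /eqP ec := nth_find 0 hx; have zA : nth 0 A (find (fun x => x.-1 %% m == c) A) \in A.
    by rewrite mem_nth // -has_find.
  by rewrite /f -[X in (_ + X)%N]ec -divn_eq prednK ?pos.
have [k _ kE] := @tup_surj m f (\max_(c < m) (f c * m + c)).+1 (fun c ltc =>
  leq_bigmax (F := fun c : 'I_m => (f c * m + c)%N) (Ordinal ltc)).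
exists k; rewrite (eq_tuple_set kE); apply/eqP; rewrite eq_sym eqEfcard.
have [_ -> _] := rainbow_tuple_set f m0; rewrite card leqnn andbT.
by apply/fsubsetP => _ /tuple_setP[c ltc ->]; exact: fA.
Qed.

Lemma revlex_gtP A B : (forall x, x \in A -> 0 < x) ->
  reflect (exists2 a, a \in A `\` B & forall b, b \in B `\` A -> b < a) (revlex_gt A B).
Proof.
move=> pos; apply: (iffP idP) => [gt|[a aAB lta]].
  have [/hasP[a aAB lta]|/hasPn nh] := boolP (has (fun a => \max_(b <- B `\` A) b < a) (A `\` B)).
    by exists a => // b bBA; apply: leq_ltn_trans lta; exact: leq_bigmax_seq.
  move: gt; rewrite /revlex_gt ltnNge => /negP[].
  by apply/bigmax_leqP_seq => a aAB _; rewrite leqNgt; exact: nh.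
have a0 : 0 < a by apply: pos; move: aAB; rewrite inE => /andP[].
apply: (@leq_trans a); last exact: leq_bigmax_seq.
apply: (@leq_ltn_trans a.-1); last by rewrite ltn_predL.
by apply/bigmax_leqP_seq => b bBA _; rewrite -ltnS prednK // lta.
Qed.

Lemma revlex_gtxx A : revlex_gt A A = false.
Proof. by rewrite /revlex_gt ltnn. Qed.

Lemma revlex_gt_tup m k k' : 0 < m -> k < k' ->
  revlex_gt (tuple_set m (tup m k')) (tuple_set m (tup m k)).
Proof.
case: m => // m _ ltk; have [u ltu] := turan_unbounded m k'.
have [c [ltc nec cP]] := tup_lt ltk ltu.
apply/revlex_gtP; first by move=> x /tuple_setP[i _ ->].
exists (tup m.+1 k' c * m.+1 + c).+1.
  by rewrite inE !mem_tuple_set // eqxx andbT eq_sym.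
move=> x; rewrite inE => /andP[+ /tuple_setP[i lti ex]].
by rewrite ex mem_tuple_set // ltnS => /(cP i lti).
Qed.

Fixpoint initial m N : {fset {fset nat}} :=
  if N is n.+1 then tuple_set m (tup m n) |` initial m n else fset0.

Lemma initialP m N A :
  reflect (exists2 k, k < N & A = tuple_set m (tup m k)) (A \in initial m N).
Proof.
elim: N => [|N IH] /=; first by rewrite inE; constructor => -[].
rewrite in_fset1U; apply: (iffP orP) => [[/eqP ->|/IH[k ltk ->]]|[k]].
- by exists N.
- by exists k => //; exact: ltnW.
rewrite ltnS leq_eqVlt => /orP[/eqP -> ->|ltk eA]; first by left.
by right; apply/IH; exists k.
Qed.

Lemma initial_fresh m N : 0 < m -> tuple_set m (tup m N) \notin initial m N.
Proof.
move=> m0; apply/negP => /initialP[k ltk e].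
by have := revlex_gt_tup m0 ltk; rewrite e revlex_gtxx.
Qed.

Lemma card_initial m N : 0 < m -> #|` initial m N| = N.
Proof.
move=> m0; elim: N => [|N IH]; first by rewrite cardfs0.
by rewrite /= cardfsU1 initial_fresh // IH.
Qed.

Lemma initial_smallest m N : 0 < m -> revlex_smallest m m N (initial m N).
Proof.
move=> m0; split; first exact: card_initial.
  by move=> A /initialP[k _ ->]; exact: rainbow_tuple_set.
move=> A B /initialP[k ltk ->] /(rainbow_tupleP m0)[k' ->] nB.
apply: revlex_gt_tup => //; apply: leq_trans ltk _; rewrite leqNgt.
by apply: contraNN nB => ltk'; apply/initialP; exists k'.
Qed.

Definition base_vertex m x := (x.-1 %% m).+1.

Lemma has_base_tuple_set m f : has_base (base_vertex m) (tuple_set m f) = ~~ all_pos m f.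
Proof.
rewrite /all_pos negb_forall; apply/hasP/existsP => [[x /tuple_setP[c ltc ->]]|[c]].
  rewrite /base_vertex /= modnMDl modn_small // eqSS => /eqP e.
  exists (Ordinal ltc) => /=; rewrite -leqNgt leqn0.
  by move: e; case: (f c) => // a; have := ltc; rewrite mulSn; lia.
rewrite -leqNgt leqn0 => /eqP fc0; exists (c : nat).+1.
  by apply/tuple_setP; exists c; rewrite // fc0.
by rewrite /base_vertex /= modn_small.
Qed.

Lemma card_initial_base m N : 0 < m ->
  (#|` [fset A in initial m N | has_base (base_vertex m) A]| + interior m N = N)%N.
Proof.
move=> m0; elim: N => [|N IH] /=.
  by rewrite interiorx0 addn0; apply/eqP; rewrite cardfs_eq0; apply/eqP/fsetP => A; rewrite !inE.
rewrite /interior big_ord_recr /= -/(interior m N).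
set A0 := tuple_set m _; set S := [fset A in initial m N | _] in IH.
have hA0 : has_base (base_vertex m) A0 = ~~ all_pos m (tup m N) by exact: has_base_tuple_set.
have nA0 : A0 \notin S by rewrite !inE /= (negbTE (initial_fresh N m0)).
have -> : [fset A in A0 |` initial m N | has_base (base_vertex m) A] =
    if all_pos m (tup m N) then S else A0 |` S.
  apply/fsetP => A; case: ifPn => ap; rewrite !inE; case: (A =P A0) => [->|] //=.
    by rewrite hA0 ap andbF.
  by rewrite hA0 ap.
case: ifP => ap; first by rewrite addnA IH addn1.
by rewrite cardfsU1 nA0 addn0 -addnA IH.
Qed.

End RainbowSets.

(** * The complex generated by the smallest rainbow sets *)

Section GeneratedComplex.
Local Open Scope fset_scope.
Variables (m N : nat) (S : {fset {fset nat}}).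
Hypothesis m_gt0 : 0 < m.
Hypothesis N_gt0 : 0 < N.
Hypothesis smallS : revlex_smallest m m N S.
Implicit Types A B : {fset nat}.

Let cardS : #|` S| = N. Proof. by case: smallS. Qed.
Let rainS A : A \in S -> rainbow m m A. Proof. by case: smallS => _ + _; apply. Qed.
Let smallestS A B : A \in S -> rainbow m m B -> B \notin S -> revlex_gt B A.
Proof. by case: smallS => _ _; apply. Qed.

Lemma generatedP A : reflect (exists2 B, B \in S & A `<=` B) (A \in generated_complex S).
Proof.
apply: (iffP idP) => [/bigfcupP[B /andP[BS _]]|[B BS AB]].
  by rewrite fpowersetE; exists B.
by apply/bigfcupP; exists B; rewrite ?BS // fpowersetE.
Qed.

Lemma generated_closed A B :
  A \in generated_complex S -> B `<=` A -> B \in generated_complex S.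
Proof.
by move=> /generatedP[C CS AC] BA; apply/generatedP; exists C; rewrite // (fsubset_trans BA).
Qed.

Lemma generated_simplicial : simplicial_complex (generated_complex S).
Proof.
split; last exact: generated_closed.
have [S0|[A AS]] := fset_0Vmem S; first by move: N_gt0; rewrite -cardS S0 cardfs0.
by apply/fset0Pn; exists A; apply/generatedP; exists A.
Qed.

Lemma faces_generated : faces (generated_complex S) m = S.
Proof.
apply/fsetP => A; rewrite !inE /=; apply/andP/idP => [[/generatedP[B BS AB] /eqP cA]|AS].
  have [_ cB _] := rainS BS.
  suff -> : A = B by [].
  by apply/eqP; rewrite eqEfcard AB cA cB leqnn.
by have [_ -> _] := rainS AS; rewrite eqxx; split=> //; apply/generatedP; exists A.
Qed.

Lemma faces_generated0 : faces (generated_complex S) m.+1 = fset0.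
Proof.
apply/fsetP => A; rewrite !inE /=; apply/negP => /andP[/generatedP[B BS /fsubset_leq_card]].
by have [_ -> _] := rainS BS => le /eqP e; rewrite e ltnn in le.
Qed.

(* A rainbow set is completed by the first vertices of the missing colours. *)
Lemma generated_revlex : revlex_closed m (generated_complex S).
Proof.
move=> j _ B C rB rC gtBC /generatedP[A AS BA].
have [posC _ injC] := (rainbowP _ _ m_gt0).1 rC.
have [posB _ _] := (rainbowP _ _ m_gt0).1 rB.
have [posA _ injA] := (rainbowP _ _ m_gt0).1 (rainS AS).
pose f c := if has (fun x => x.-1 %% m == c) C
  then (nth 0 C (find (fun x => x.-1 %% m == c) C)).-1 %/ m else 0.
pose C' := tuple_set m f.
have rC' : rainbow m m C' by exact: rainbow_tuple_set.
have [posC' _ injC'] := (rainbowP _ _ m_gt0).1 rC'.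
have C'P x : x \in C' -> (x \in C) || (x <= m).
  move=> /tuple_setP[c ltc ->]; rewrite /f; case: ifP => [h|_]; last by rewrite mul0n ltc orbT.
  have /eqP ec := nth_find 0 h; set z := nth _ _ _ in ec *.
  have zC : z \in C by rewrite mem_nth // -has_find.
  by rewrite -[X in (_ + X)%N]ec -divn_eq prednK ?posC // zC.
have CC' : C `<=` C'.
  apply/fsubsetP => x xC; apply/tuple_setP; exists (x.-1 %% m); first by rewrite ltn_pmod.
  have h : has (fun y => y.-1 %% m == x.-1 %% m) C by apply/hasP; exists x.
  have /eqP ec := nth_find 0 h; rewrite /f h; set z := nth _ _ _ in ec *.
  have zC : z \in C by rewrite mem_nth // -has_find.
  by rewrite (injC z x zC xC ec) -divn_eq prednK ?posC.
apply/generatedP; exists C' => //; apply/negPn/negP => nC'S.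
have /(revlex_gtP _ posC')[w] := smallestS AS rC' nC'S.
rewrite inE => /andP[wA wC'] lew.
have wB : w \notin B by apply: contraNN wA => /(fsubsetP BA).
(* If [w] is the first vertex of its colour, the vertex of that colour in [A] would have to be
   smaller, which is impossible. *)
have [lewm|ltmw] := leqP w m.
  have w0 := posC' w wC'.
  have [x xA ex] := rainbow_color (ltn_pmod w.-1 m_gt0) (rainS AS).
  have nxw : x != w by apply: contraNneq wA => <-.
  have xC' : x \notin C' by apply: contra_neqN nxw => xC'; exact: injC'.
  have := lew x; rewrite inE xA xC' => /(_ isT) ltxw.
  by move: nxw; rewrite (small_color_inj (posA x xA) w0 _ lewm ex) ?eqxx // ltnW // (leq_trans ltxw).
(* Otherwise [w] lies in [C] and not in [B], so some [u] in [B] outside [C] exceeds it; [u]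
   contradicts the choice of [w] whether or not it was added to [C']. *)
have wC : w \in C by have := C'P w wC'; rewrite [w <= m]leqNgt ltmw orbF.
move: gtBC => /(revlex_gtP _ posB)[u]; rewrite inE => /andP[uC uB] ltu.
have ltwu : w < u by apply: ltu; rewrite inE wB wC.
have uA : u \in A by exact: (fsubsetP BA).
have [uC'|nuC'] := boolP (u \in C').
  by have := C'P u uC'; rewrite (negbTE uC) /= leqNgt (ltn_trans ltmw).
by have := lew u; rewrite inE uA nuC' ltnNge (ltnW ltwu) => /(_ isT).
Qed.

Lemma generated_revlex_complex : revlex_complex m (generated_complex S).
Proof.
split; [exact: generated_simplicial| |exact: generated_revlex].
move=> A /generatedP[B BS AB]; exists #|` A|.
exact: rainbow_sub m_gt0 (rainS BS) AB.
Qed.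

(** Replacing a vertex by the first one of its colour lowers a set in revlex order. *)
Lemma base_shifted_smallest : base_shifted (base_vertex m) S.
Proof.
move=> A w AS wA nw; have rA := rainS AS.
have [posA cA injA] := (rainbowP _ _ m_gt0).1 rA.
have w0 := posA w wA.
have col : (base_vertex m w).-1 %% m = w.-1 %% m by rewrite /base_vertex /= modn_mod.
have bA : base_vertex m w \notin A by apply: contra_neqN nw => bA; exact: injA.
split=> //; set B := _ |` _; apply/negPn/negP => nB.
have ltbw : base_vertex m w < w.
  by rewrite ltn_neqAle nw /base_vertex /= -[w in X in _ <= X]prednK // ltnS leq_mod.
have rB : rainbow m m B.
  apply/(rainbowP _ _ m_gt0); split.
  - by move=> x; rewrite !inE => /orP[/eqP ->|/andP[_ /posA]].
  - rewrite /B cardfsU1 !inE (negbTE bA) andbF /= -cA [in RHS](cardfsD1 w) wA.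
    by [].
  move=> x y; rewrite !inE => /orP[/eqP->|/andP[nx xA]] /orP[/eqP->|/andP[ny yA]] //.
  - by rewrite col => /(injA w y wA yA) e; rewrite e eqxx in ny.
  - by rewrite col => /(injA x w xA wA) e; rewrite e eqxx in nx.
  - exact: injA.
have [posB _ _] := (rainbowP _ _ m_gt0).1 rB.
have /(revlex_gtP _ posB)[a] := smallestS AS rB nB.
rewrite !inE => /andP[aA]; rewrite (negbTE aA) andbF orbF => /eqP ea /(_ w).
by rewrite !inE wA eqxx orbF andbT eq_sym nw ea ltnNge (ltnW ltbw) => /(_ isT).
Qed.

(** If [S] is not contained in the facets of [G], then by equal cardinality [G] has a facet outside
    [S]; it exceeds every member of [S], and revlex closure puts them all into [G]. *)
Lemma revlex_complex_sub G : revlex_complex m G -> #|` faces G m| = N ->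
  generated_complex S `<=` G.
Proof.
move=> [[_ closedG] colG revG] cG.
have rG A : A \in faces G m -> rainbow m m A.
  rewrite !inE /= => /andP[/colG[j rA] /eqP cA].
  by have [_ e _] := rA; move: rA; rewrite -e cA.
suff SG : S `<=` faces G m.
  apply/fsubsetP => A /generatedP[B /(fsubsetP SG) + AB].
  by rewrite !inE => /andP[BG _]; exact: closedG AB.
apply/fsubsetP => A AS; apply/negPn/negP => nA.
have [B BG nB] : exists2 B, B \in faces G m & B \notin S.
  apply/fsubsetPn; apply: contraNN nA => GS.
  suff -> : faces G m = S by [].
  by apply/eqP; rewrite eqEfcard GS cG cardS leqnn.
have gt := smallestS AS (rG B BG) nB.
move: nA; rewrite !inE /=; have [_ -> _] := rainS AS; rewrite eqxx andbT => /negP[].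
have mm : 0 < m <= m by rewrite m_gt0 leqnn.
apply: (revG m mm B A (rG B BG) (rainS AS) gt).
by move: BG; rewrite !inE => /andP[].
Qed.

End GeneratedComplex.

Lemma betti_initial (F : fieldType) d N : 0 < N ->
  interior d.+1 N <= betti F (generated_complex (initial d.+1 N)) d.
Proof.
move=> N0; set S := initial _ _; have smallS : revlex_smallest d.+1 d.+1 N S by exact: initial_smallest.
rewrite betti_top ?(faces_generated0 smallS) // (faces_generated smallS) // card_initial //.
have := @card_initial_base d.+1 N isT; rewrite -/S.
have := @rk_base_shifted F _ _ (@generated_closed S) (base_vertex d.+1) _ S _
  (base_shifted_smallest (ltn0Sn d) smallS).
move=> H; have {H} : rk F (generated_complex S) S <= #|` [fset A in S | has_base (base_vertex d.+1) A]|%fset.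
  apply: H; first by move=> w; rewrite /base_vertex /= modn_mod.
  by apply/fsubsetP => A AS; apply/generatedP; exists A.
lia.
Qed.

Theorem theorem4p2 (F : fieldType) (K : choiceType) (D : {fset {fset K}})
    (d : nat) (flagD : flag_complex D) (dimD : has_dim D d) :
  exists G : {fset {fset nat}},
    [/\ unique (minimal_complex
          (fun G' => revlex_complex d.+1 G' /\ fnum G' d = fnum D d)) G,
        exists2 S, revlex_smallest d.+1 d.+1 (fnum D d) S & G = generated_complex S
      & (betti F D d <= betti F G d)%N].
Proof.
set N := fnum D d.
have N0 : 0 < N.
  have [/eqP|[A AF]] := fset_0Vmem (faces D d.+1); last by rewrite cardfs_gt0; apply/fset0Pn; exists A.
  move=> /eqP F0; have : \max_(A <- D) #|` A|%fset <= d.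
    apply/bigmax_leqP_seq => A AD _; rewrite -ltnS ltn_neqAle.
    have -> : #|` A|%fset <= d.+1 by rewrite -dimD; exact: leq_bigmax_seq.
    rewrite andbT; apply/negP => cA.
    have : A \in faces D d.+1 by rewrite !inE /= AD.
    by rewrite F0 inE.
  by rewrite dimD ltnn.
have F0 : faces D d.+2 = fset0.
  apply/fsetP => A; rewrite !inE /=; apply/negP => /andP[AD /eqP cA].
  have : #|` A|%fset <= d.+1 by rewrite -dimD; exact: leq_bigmax_seq.
  by rewrite cA ltnn.
have smallS := @initial_smallest d.+1 N isT.
exists (generated_complex (initial d.+1 N)); split.
- have PG : revlex_complex d.+1 (generated_complex (initial d.+1 N)) /\
      fnum (generated_complex (initial d.+1 N)) d = N.
    split; first exact: generated_revlex_complex smallS.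
    by rewrite /fnum (faces_generated smallS) ?card_initial.
  (* The generated complex is contained in every competitor, which gives both minimality and
     uniqueness. *)
  split.
    split=> // G' [rG' cG'] G'G; apply/eqP; rewrite eqEfsubset G'G.
    exact: revlex_complex_sub smallS _ rG' cG'.
  move=> G' [[rG' cG'] minG']; apply: minG' => //.
  exact: revlex_complex_sub smallS _ rG' cG'.
- by exists (initial d.+1 N).
apply: leq_trans (betti_initial F d N0).
exact: betti_flag_le.
Qed.
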